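(* Assume that $\Gamma$ is an inverse semigroupoid (with involution $\alpha^*=\alpha'$), and let $K$ be a $\Gamma$-invariant $\boldsymbol H$-operator valued kernel on $X$ which is partially positive semidefinite with respect to the partition $P_a=\{X_s\}_{s\in S}$. Let $K^s=K|_{X_s\times X_s}$ and $\boldsymbol R=\{\mathcal R_{K^s}\}_{s\in S}$, where $\mathcal R_{K^s}$ is the reproducing kernel Hilbert space of $K^s$. Then the following assertions are true. (1) $K$ is of bounded shift type. (2) There exists a unique $*$-representation $(\mathrm{Id}_S,\Phi)$, $\Phi\colon\Gamma\to\Gamma_{\boldsymbol R}$, such that $K^{c(\alpha)}_{\alpha\cdot x}=\Phi(\alpha)K^{d(\alpha)}_x$ for all $\alpha\in\Gamma$ and $x\in X_{d(\alpha)}$. (3) There exists a minimal $\Gamma$-invariant Hilbert space linearisation $(\boldsymbol K;\boldsymbol V;\Psi)$ of $K$, which is unique modulo unitary equivalence in the following sense: whenever $(\boldsymbol K';\boldsymbol V';\Psi')$ is another minimal $\Gamma$-invariant Hilbert space linearisation of $K$, there exists a bundle of unitary operators $\boldsymbol U=\{U_s\}_{s\in S}$ such that $U_s\colon\mathcal K_s\to\mathcal K'_s$ for all $s\in S$; $U_{c(\alpha)}\Psi(\alpha)=\Psi'(\alpha)U_{d(\alpha)}$ for all $\alpha\in\Gamma$; and $U_{a(x)}V_x=V'_x$ for all $x\in X$.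
   Context: $\mathbb F$ is $\mathbb R$ or $\mathbb C$. $\mathcal B(\mathcal H,\mathcal G)$ is the space of bounded linear operators. Semigroupoids. A semigroupoid $(\Gamma;S;d;c;\cdot)$ consists of nonempty sets $\Gamma$ and $S$ (the set of symbols), maps $d,c\colon\Gamma\to S$ (domain and codomain maps), and a product $\alpha\beta\in\Gamma$ defined whenever $d(\alpha)=c(\beta)$ (the set of such pairs is $\Gamma^{(2)}$), with $d(\alpha\beta)=d(\beta)$, $c(\alpha\beta)=c(\alpha)$, and $\alpha(\beta\gamma)=(\alpha\beta)\gamma$ whenever $d(\alpha)=c(\beta)$, $d(\beta)=c(\gamma)$. Put $\Gamma_s=\{\alpha\mid d(\alpha)=s\}$, $\Gamma^t=\{\alpha\mid c(\alpha)=t\}$, $\Gamma_s^t=\Gamma_s\cap\Gamma^t$. A semigroupoid is an inverse semigroupoid if for any $\alpha\in\Gamma$ there is a unique $\alpha'\in\Gamma$ with $\alpha\alpha'\alpha=\alpha$ and $\alpha'\alpha\alpha'=\alpha'$ (so $d(\alpha')=c(\alpha)$, $c(\alpha')=d(\alpha)$). Then $(\alpha')'=\alpha$ and $(\alpha\beta)'=\beta'\alpha'$ for $(\alpha,\beta)\in\Gamma^{(2)}$, and $\Gamma$ is regarded as a $*$-semigroupoid with $\alpha^*:=\alpha'$. A left action $(a;\cdot)$ of $\Gamma$ on a nonempty set $X$ consists of a surjective map $a\colon X\to S$ (the anchor) and, for each $x\in X$ and $\alpha\in\Gamma_{a(x)}$, an element $\alpha\cdot x\in X$ with $a(\alpha\cdot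 x)=c(\alpha)$, such that $(\alpha\beta)\cdot x=\alpha\cdot(\beta\cdot x)$ for $(\alpha,\beta)\in\Gamma^{(2)}$, $\beta\in\Gamma_{a(x)}$. Setting. $S$ is the symbol set of $\Gamma$, $(a;\cdot)$ is a left action of $\Gamma$ on the nonempty set $X$, $X_s=a^{-1}(\{s\})$, $P_a=\{X_s\}_{s\in S}$. $\boldsymbol H=\{\mathcal H_x\}_{x\in X}$ is a bundle (family) of Hilbert spaces over $\mathbb F$ such that $\mathcal H_{\alpha\cdot x}=\mathcal H_x$ for all $x\in X$, $\alpha\in\Gamma_{a(x)}$. $\boldsymbol H_s=\{\mathcal H_x\}_{x\in X_s}$. $\mathcal F_{\mathbb F}(X_s;\boldsymbol H_s)=\prod_{x\in X_s}\mathcal H_x$ is the vector space of sections ($f_x=f(x)\in\mathcal H_x$), and $\mathcal F^0_{\mathbb F}(X_s;\boldsymbol H_s)$ its subspace of sections with finite support. An $\boldsymbol H$-operator valued kernel $K$ on $X$ is a map on $X\times X$ with $K(x,y)\in\mathcal B(\mathcal H_y,\mathcal H_x)$. $K$ is $\Gamma$-invariant if $K(\alpha\cdot x,y)=K(x,\alpha^*\cdot y)$ for all $x,y\in X$ and $\alpha\in\Gamma_{a(x)}^{a(y)}$. $K$ is partially positive semidefinite with respect to $P_a$ if for every $s\in S$, $K(x,y)^*=K(y,x)$ for $x,y\in X_s$, and $\sum_{i,j=1}^n\langle K(x_j,x_i)h_i,h_j\rangle_{\mathcal H_{x_j}}\ge0$ for all $n\in\mathbb N$, $x_1,\dots,x_n\in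 X_s$, $h_i\in\mathcal H_{x_i}$. $K$ is of bounded shift type if for all $\alpha\in\Gamma$ there is $M_\alpha\ge0$ such that for every $g\in\mathcal F^0_{\mathbb F}(X_{d(\alpha)};\boldsymbol H_{d(\alpha)})$, $$\sum_{x,y\in X_{d(\alpha)}}\langle K(\alpha\cdot x,\alpha\cdot y)g_y,g_x\rangle_{\mathcal H_x}\le M_\alpha\sum_{x,y\in X_{d(\alpha)}}\langle K(x,y)g_y,g_x\rangle_{\mathcal H_x}.$$ Reproducing kernel Hilbert spaces. For $x\in X_s$, $h\in\mathcal H_x$, $K^s_xh=K^s(\cdot,x)h$. $\mathcal R_{K^s}$ is the (unique) Hilbert space which is a linear subspace of $\mathcal F_{\mathbb F}(X_s;\boldsymbol H_s)$, contains all $K^s_xh$, and satisfies $\langle f(x),h\rangle_{\mathcal H_x}=\langle f,K^s_xh\rangle_{\mathcal R_{K^s}}$ for all $f\in\mathcal R_{K^s}$, $x\in X_s$, $h\in\mathcal H_x$. $K^s_x$ is regarded as a bounded operator $\mathcal H_x\to\mathcal R_{K^s}$. Representations. For a bundle of Hilbert spaces $\boldsymbol K=\{\mathcal K_s\}_{s\in S}$, $\Gamma_{\boldsymbol K}=\bigsqcup_{s,t\in S}\mathcal B(\mathcal K_s,\mathcal K_t)$ is a $*$-semigroupoid under composition and Hilbert space adjoint. A $*$-representation $(\mathrm{Id}_S,\Phi)$ of $\Gamma$ on $\Gamma_{\boldsymbol K}$ is a map $\Phi\colon\Gamma\to\Gamma_{\boldsymbol K}$ with $\Phi(\alpha)\in\mathcal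 B(\mathcal K_{d(\alpha)},\mathcal K_{c(\alpha)})$, $\Phi(\alpha\beta)=\Phi(\alpha)\Phi(\beta)$ for $(\alpha,\beta)\in\Gamma^{(2)}$, and $\Phi(\alpha^* )=\Phi(\alpha)^*$. A $\Gamma$-invariant Hilbert space linearisation of $K$ is a triple $(\boldsymbol K;\boldsymbol V;\Psi)$ with: (IL1) $\boldsymbol K=\{\mathcal K_s\}_{s\in S}$ a bundle of Hilbert spaces; (IL2) $\boldsymbol V=\{V_x\}_{x\in X}$, $V_x\in\mathcal B(\mathcal H_x,\mathcal K_{a(x)})$, with $K(x,y)=V_x^*V_y$ for all $x,y$ with $a(x)=a(y)$; (IL3) $(\mathrm{Id}_S;\Psi)$ a $*$-representation of $\Gamma$ on $\Gamma_{\boldsymbol K}$ with $\Psi(\alpha)V_x=V_{\alpha\cdot x}$ for all $x\in X$, $\alpha\in\Gamma_{a(x)}$. It is minimal if (IL4) each $\mathcal K_s$ is the closed span of $\{V_x\mathcal H_x\mid x\in X,\ a(x)=s\}$. *)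

(* Defs.v *)
From HB Require Import structures.
From mathcomp Require Import all_boot all_order all_algebra.
From mathcomp Require Import complex.
From mathcomp Require Import all_classical all_reals all_analysis.

Set Implicit Arguments.
Unset Strict Implicit.
Unset Printing Implicit Defensive.

Import Order.TTheory GRing.Theory Num.Theory.
Import numFieldNormedType.Exports.

Local Open Scope classical_set_scope.
Local Open Scope ring_scope.

Variant scalar_kind := RealScalars | ComplexScalars.

(* On R[i] the order is partial: 0 <= z means that z is real and
   nonnegative. *)
Definition scalar (R : realType) (k : scalar_kind) : numFieldType :=
  match k with
  | RealScalars => (R : numFieldType)
  | ComplexScalars => (R[i] : numFieldType)
  end.

Definition scalar_conj (R : realType) (k : scalar_kind) :
    {rmorphism scalar R k -> scalar R k} :=
  match k return {rmorphism scalar R k -> scalar R k} with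
  | RealScalars => (idfun : {rmorphism R -> R})
  | ComplexScalars => (Num.conj : {rmorphism R[i] -> R[i]})
  end.

Section Hilbert.
Variables (R : realType) (k : scalar_kind).
Local Notation F := (scalar R k).

(* The inner product is linear in its first argument. *)
Record hilbert := Hilbert {
  hilbert_sort :> completeNormedModType F;
  dotp : {dot hilbert_sort for scalar_conj R k};
  dotp_norm : forall u : hilbert_sort, dotp u u = `|u| ^+ 2
}.

Record bounded_op (V W : hilbert) := BoundedOp {
  bounded_op_fun :> {linear V -> W};
  bounded_opP : exists M : F, forall v : V,
    `|bounded_op_fun v| <= M * `|v|
}.

Definition is_adjoint (V W : hilbert) (T : V -> W) (T' : W -> V) : Prop :=
  forall u v, dotp W (T u) v = dotp V u (T' v).

Definition unitary (V W : hilbert) (U : bounded_op V W) : Prop :=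
  (forall u v, dotp W (U u) (U v) = dotp V u v) /\
  (forall w, exists u, U u = w).

(* The identity map between two Hilbert spaces which are equal, but not
   syntactically so. *)
Definition hcast (V W : hilbert) (e : V = W) (v : V) : W :=
  match e in _ = W return hilbert_sort W with erefl => v end.

Definition linear_span (V : lmodType F) (A : set V) : set V :=
  [set v | exists (n : nat) (c : 'I_n -> F) (u : 'I_n -> V),
    (forall i, A (u i)) /\ v = \sum_(i < n) c i *: u i].

End Hilbert.

Arguments dotp {R k} h.

Section Kernel.
Variables (R : realType) (k : scalar_kind).
Variables (Y : Type) (H : Y -> hilbert R k).

Definition operator_kernel := forall x y : Y, bounded_op (H y) (H x).

Definition positive_semidefinite (K : operator_kernel) : Prop :=
  (forall x y, is_adjoint (K x y) (K y x)) /\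
  (forall (n : nat) (x : 'I_n -> Y) (h : forall i, H (x i)),
    0 <= \sum_(i < n) \sum_(j < n)
           dotp (H (x j)) (K (x j) (x i) (h i)) (h j)).

Definition finitely_supported (g : forall y, H y) : Prop :=
  finite_set [set y | g y != 0].

(* A vector f of the space stands for the section x |-> rk_eval x f; since
   the evaluations are jointly injective, this makes rk_space a linear subspace
   of the space of all sections.  rk_section x h stands for K_x h. *)
Record rkhs (K : operator_kernel) := RKHS {
  rk_space :> hilbert R k;
  rk_eval : forall x : Y, {linear rk_space -> H x};
  rk_eval_inj : forall f g : rk_space,
    (forall x, rk_eval x f = rk_eval x g) -> f = g;
  rk_section : forall x : Y, H x -> rk_space;
  rk_sectionE : forall (x : Y) (h : H x) (y : Y),
    rk_eval y (rk_section h) = K y x h;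
  rk_reproducing : forall (f : rk_space) (x : Y) (h : H x),
    dotp (H x) (rk_eval x f) h = dotp rk_space f (rk_section h)
}.

End Kernel.

Arguments rk_section {R k Y H K} r x h.

(* The product is total; its values at pairs (a, b) with dom a <> cod b are
   irrelevant and never constrained or used. *)
Record semigroupoid := Semigroupoid {
  sg_sort :> Type;
  symbol : Type;
  sg_inhabited : inhabited sg_sort;
  symbol_inhabited : inhabited symbol;
  dom : sg_sort -> symbol;
  cod : sg_sort -> symbol;
  sg_mul : sg_sort -> sg_sort -> sg_sort;
  dom_mul : forall a b, dom a = cod b -> dom (sg_mul a b) = dom b;
  cod_mul : forall a b, dom a = cod b -> cod (sg_mul a b) = cod a;
  sg_mulA : forall a b c, dom a = cod b -> dom b = cod c ->
    sg_mul a (sg_mul b c) = sg_mul (sg_mul a b) c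
}.

(* The first two conditions say that the products a b a and b a b are
   defined. *)
Definition is_inverse (G : semigroupoid) (a b : G) : Prop :=
  [/\ dom a = cod b, dom b = cod a,
      sg_mul (sg_mul a b) a = a & sg_mul (sg_mul b a) b = b].

Record inverse_semigroupoid := InverseSemigroupoid {
  isg_sort :> semigroupoid;
  sg_inv : isg_sort -> isg_sort;
  sg_invP : forall a, is_inverse a (sg_inv a);
  sg_inv_unique : forall a b, is_inverse a b -> b = sg_inv a
}.

Lemma dom_inv (G : inverse_semigroupoid) (a : G) : dom (sg_inv a) = cod a.
Proof. by case: (sg_invP a). Qed.

Lemma cod_inv (G : inverse_semigroupoid) (a : G) : cod (sg_inv a) = dom a.
Proof. by case: (sg_invP a). Qed.

(* As for the product, act a x is only meaningful when dom a = anchor x. *)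
Record left_action (G : semigroupoid) (X : Type) := LeftAction {
  action_inhabited : inhabited X;
  anchor : X -> symbol G;
  anchor_surj : forall s, exists x, anchor x = s;
  act : G -> X -> X;
  anchor_act : forall a x, dom a = anchor x -> anchor (act a x) = cod a;
  act_mul : forall a b x, dom a = cod b -> dom b = anchor x ->
    act (sg_mul a b) x = act a (act b x)
}.

Section Fibre.
Variables (G : semigroupoid) (X : Type) (A : left_action G X).

Definition fibre (s : symbol G) : set X := [set x | anchor A x = s].

Lemma fibreP (s : symbol G) (x : fibre s) : s = anchor A (val x).
Proof. by have /set_mem/= := valP x. Qed.

Lemma act_fibre_subproof (a : G) (x : fibre (dom a)) :
  act A a (val x) \in fibre (cod a).
Proof. by apply/mem_set; exact: anchor_act (fibreP x). Qed.

Definition act_fibre (a : G) (x : fibre (dom a)) : fibre (cod a) :=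
  exist _ (act A a (val x)) (act_fibre_subproof x).

End Fibre.

Record invariant_bundle (R : realType) (k : scalar_kind)
    (G : semigroupoid) (X : Type) (A : left_action G X) := InvariantBundle {
  bundle :> X -> hilbert R k;
  bundle_act : forall (x : X) (a : G), dom a = anchor A x ->
    bundle (act A a x) = bundle x
}.

Section InvariantKernels.
Variables (R : realType) (k : scalar_kind).
Variables (G : inverse_semigroupoid) (X : Type) (A : left_action G X).
Variable (H : invariant_bundle R k A).
Local Notation F := (scalar R k).

(* H_x = H_(a . x), in both directions. *)
Definition to_act (x : X) (a : G) (e : dom a = anchor A x) :
  H x -> H (act A a x) := hcast (esym (bundle_act H e)).

Definition of_act (x : X) (a : G) (e : dom a = anchor A x) :
  H (act A a x) -> H x := hcast (bundle_act H e).

Definition invariant_kernel (K : operator_kernel H) : Prop :=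
  forall (x y : X) (a : G)
    (ex : dom a = anchor A x) (ey : cod a = anchor A y) (h : H y),
  of_act ex (K (act A a x) y h) =
  K x (act A (sg_inv a) y) (to_act (etrans (dom_inv a) ey) h).

Definition fibre_bundle (s : symbol G) (x : fibre A s) : hilbert R k :=
  H (val x).

Definition fibre_kernel (K : operator_kernel H) (s : symbol G) :
    operator_kernel (@fibre_bundle s) :=
  fun x y => K (val x) (val y).
Arguments fibre_kernel K s : clear implicits.

Definition partially_positive_semidefinite (K : operator_kernel H) : Prop :=
  forall s, positive_semidefinite (fibre_kernel K s).

Definition bounded_shift_type (K : operator_kernel H) : Prop :=
  forall a : G, exists M : F, 0 <= M /\
  forall g : forall x : fibre A (dom a), fibre_bundle x,
  finitely_supported g ->
  \sum_(x \in [set: {classic fibre A (dom a)}])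
  \sum_(y \in [set: {classic fibre A (dom a)}])
     dotp (H (val x))
       (of_act (fibreP x)
          (K (act A a (val x)) (act A a (val y)) (to_act (fibreP y) (g y))))
       (g x)
  <= M *
  \sum_(x \in [set: {classic fibre A (dom a)}])
  \sum_(y \in [set: {classic fibre A (dom a)}])
     dotp (H (val x)) (K (val x) (val y) (g y)) (g x).

Section Representations.
Variable (B : symbol G -> hilbert R k).

Definition scast (s t : symbol G) (e : s = t) : B s -> B t :=
  hcast (congr1 B e).
Arguments scast {s t} e v.

Definition star_representation
    (Phi : forall a : G, bounded_op (B (dom a)) (B (cod a))) : Prop :=
  (forall (a b : G) (e : dom a = cod b) (v : B (dom b)),
     scast (cod_mul e) (Phi (sg_mul a b) (scast (esym (dom_mul e)) v)) =
     Phi a (scast (esym e) (Phi b v))) /\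
  (forall a : G,
     is_adjoint (Phi a)
       (fun v => scast (cod_inv a)
                   (Phi (sg_inv a) (scast (esym (dom_inv a)) v)))).

End Representations.

Arguments scast B {s t} e v.

Record invariant_linearisation (K : operator_kernel H) := InvariantLinearisation {
  il_space : symbol G -> hilbert R k;
  il_op : forall x : X, bounded_op (H x) (il_space (anchor A x));
  il_rep : forall a : G, bounded_op (il_space (dom a)) (il_space (cod a));
  il_factor : forall (x y : X) (e : anchor A x = anchor A y),
    exists2 Vx' : bounded_op (il_space (anchor A x)) (H x),
      is_adjoint (il_op x) Vx' &
      forall h : H y, K x y h = Vx' (scast il_space (esym e) (il_op y h));
  il_star_rep : star_representation il_rep;
  il_intertwine : forall (x : X) (a : G) (e : dom a = anchor A x) (h : H x),
    il_rep a (scast il_space (esym e) (il_op x h)) =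
    scast il_space (anchor_act e) (il_op (act A a x) (to_act e h))
}.

Definition minimal_linearisation (K : operator_kernel H)
    (L : invariant_linearisation K) : Prop :=
  forall s : symbol G,
  closure (linear_span
    [set v : il_space L s | exists (x : X) (e : anchor A x = s) (h : H x),
       v = scast (il_space L) e (il_op L x h)]) = setT.

End InvariantKernels.

Arguments fibre_kernel {R k G X A H} K s.

(* Main.v *)
Require Import Defs.
From HB Require Import structures.
From mathcomp Require Import all_boot all_order all_algebra.
From mathcomp Require Import complex ring.
From mathcomp Require Import all_classical all_reals all_analysis.

(** Everything reduces to one estimate on formal vectors.  Call a pair of a
    point x and a vector h of H_x a formal vector over the symbol a(x); it
    stands for K_x h, and finite sums of such vectors over a symbol s carry the
    semi-inner product < , > whose matrix is the kernel.  Each alpha shifts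
    formal vectors over d(alpha) to formal vectors over c(alpha), and
    invariance of the kernel says that the shifts by alpha and by alpha' are
    adjoint to each other ([entry_shift]).  Since alpha alpha' alpha = alpha,
    the operator P, the shift by alpha followed by that by alpha', is a
    symmetric idempotent, so that
      0 <= <v - P v, v - P v> = <v, v> - <P v, v>,
    where <P v, v> is the square norm of the shifted vector.  Shifts are
    therefore contractions ([form_shift_le]), and the kernel is of bounded shift
    type with constant 1.

    Consider next, for each s, a Hilbert space with a total family of vectors
    indexed by the formal vectors over s and with the kernel as Gram matrix.
    Contractions extend by continuity ([extension]), so that each shift induces
    a bounded operator.  On the total family the products and the adjoints of
    these operators are known, hence they form a representation
    ([intertwines_star]), and density makes it the only one that acts by shifts.
    Two such families, having the same Gram matrix, are related by unitary
    operators ([unitary_of_gram]).  These facts apply to the vectors K_x h in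
    the reproducing kernel spaces, which gives the representation and a minimal
    linearisation, and to the vectors V_x h in an arbitrary minimal
    linearisation, which gives uniqueness.

    It remains to have the spaces.  The completion of a semi-inner product
    space V is built inside the functions on V, as the closure of the
    functionals <v, -> in the dual norm; its inner product is the limit of f(v)
    as v approaches g ([dot_exists]).  Applied to formal vectors this yields a
    Kolmogorov decomposition of the kernel, and the reproducing kernel space
    ([rkhs_exists]).  That the vectors K_x h are total in every reproducing
    kernel space, not only in the one constructed, rests on the projection
    theorem ([total_family_of_orthogonal]). *)

Set Implicit Arguments.
Unset Strict Implicit.
Unset Printing Implicit Defensive.

Import Order.TTheory GRing.Theory Num.Theory.
Import numFieldNormedType.Exports.

Local Open Scope classical_set_scope.
Local Open Scope ring_scope.

(** * Approximation in normed spaces *)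

(** Completeness in a form that mentions neither filters nor sequences: P e u
    reads that u lies within e of the point to be found.  Approximations often
    come with a natural error bound, so that this form applies to them without
    a choice of sequence. *)
Definition has_limits (F : numFieldType) (W : normedZmodType F) : Prop :=
  forall P : F -> W -> Prop,
    (forall e : F, 0 < e -> exists u, P e u) ->
    (forall (e e' : F) u v, 0 < e -> 0 < e' -> P e u -> P e' v ->
       `|u - v| <= e + e') ->
  exists p, forall (e : F) u, 0 < e -> P e u -> `|u - p| <= e.

Section Approximation.
Variable F : numFieldType.
Implicit Types x y c e : F.

Lemma pos_lower x y : 0 < x -> 0 < y -> exists2 e, 0 < e & e <= x /\ e <= y.
Proof.
move=> x0 y0; have [xy|yx] := real_leP (gtr0_real x0) (gtr0_real y0).
  by exists x.
by exists y => //; split=> //; exact: ltW.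
Qed.

(** The restriction e <= 1 lets quadratic error terms be absorbed in c * e. *)
Lemma ler_addeps c x y : 0 <= x -> 0 <= y -> 0 <= c ->
  (forall e, 0 < e -> e <= 1 -> x <= y + c * e) -> x <= y.
Proof.
move=> x0 y0 c0 xy.
have [//|yx] := real_leP (ger0_real x0) (ger0_real y0).
have c1 : 0 < c + 1 by rewrite ltr_wpDl.
have d0 : 0 < (x - y) / (c + 1) by rewrite divr_gt0 ?subr_gt0.
have [e e0 [ed e1]] := pos_lower d0 ltr01.
have := le_trans (xy _ e0 e1) (lerD (lexx y) (ler_wpM2l c0 ed)).
rewrite -lerBlDl mulrA ler_pdivlMr// mulrC.
by rewrite ler_pM2r ?subr_gt0// gerDl ler10.
Qed.

Lemma le_eps_eq0 (W : normedZmodType F) (w : W) c : 0 <= c ->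
  (forall e, 0 < e -> e <= 1 -> `|w| <= c * e) -> w = 0.
Proof.
move=> c0 H; apply/eqP; rewrite -normr_le0.
by apply: (@ler_addeps c) => // e e0 e1; rewrite add0r H.
Qed.

(** The points that are e'-approximate for some e' <= e form, as e varies, the
    base of a Cauchy filter. *)
Lemma complete_has_limits (W : completeNormedModType F) :
  has_limits (W : normedZmodType F).
Proof.
move=> P P_ex P_close.
pose B e : set W := [set w | exists2 e', 0 < e' <= e & P e' w].
pose Q : set_system W := [set D | exists2 e, 0 < e & B e `<=` D].
have QF : ProperFilter Q.
  split.
    by move=> [e e0 Be]; have [u Pu] := P_ex _ e0; apply: (Be u);
      exists e; rewrite ?e0 ?lexx.
  split.
  - by exists 1.
  - move=> D D' [e e0 De] [e' e'0 De'].
    have [d d0 [de de']] := pos_lower e0 e'0.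
    exists d => // w [b /andP[b0 bd] Pb]; split.
      by apply: De; exists b => //; rewrite b0 (le_trans bd).
    by apply: De'; exists b => //; rewrite b0 (le_trans bd).
  - by move=> D D' DD' [e e0 De]; exists e => //; exact: subset_trans DD'.
have /cauchy_cvg/cvg_ex[p /fcvgrPdist_lt Qp] : cauchy Q.
  apply/cauchy_ballP => e e0 /=.
  have e4 : 0 < e / 4 by rewrite divr_gt0.
  exists (B (e / 4), B (e / 4)); first by split; exists (e / 4).
  move=> [u v] [[a /andP[a0 ae] Pa] [b /andP[b0 be] Pb]] /=.
  rewrite -ball_normE /ball_ /=.
  apply: (le_lt_trans (P_close _ _ _ _ a0 b0 Pa Pb)).
  rewrite (le_lt_trans (lerD ae be))// -mulrDr gtr_pMr//.
  rewrite -(_ : 2^-1 = 4^-1 + 4^-1); last by field.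
  by rewrite invf_lt1 ?ltr1n.
exists p => e u e0 Pu; apply: (@ler_addeps 2) => // [|d d0 _].
  exact: ltW.
have [b b0 Bb] := Qp d d0.
have [c c0 [cb cd]] := pos_lower b0 d0.
have [v Pv] := P_ex _ c0.
have pv : `|p - v| <= d by apply/ltW/Bb; exists c => //; rewrite c0.
rewrite -(subrK v u) -addrA (le_trans (ler_normD _ _))//.
(* Letting c tend to 0 in |u - v| <= e + c recovers the sharp bound e. *)
rewrite distrC in pv.
rewrite (le_trans (lerD (P_close _ _ _ _ e0 c0 Pu Pv) pv))//.
by rewrite -addrA lerD2l mulr_natl mulr2n lerD2r.
Qed.

End Approximation.

(** * The scalar fields *)

Section Scalars.
Variables (R : realType) (k : scalar_kind).
Local Notation F := (Defs.scalar R k).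
Local Notation theta := (scalar_conj R k).

Lemma scalar_conjK : involutive theta.
Proof. by case: k => z //=; exact: conjCK. Qed.

Lemma mul_scalar_conj (z : F) : z * theta z = `|z| ^+ 2.
Proof.
case: k z => z /=; last by rewrite normCK.
by rewrite real_normK ?num_real// expr2.
Qed.

Lemma ger0_scalar_conj (z : F) : 0 <= z -> theta z = z.
Proof. by case: k z => z //= z0; apply/CrealP/ger0_real. Qed.

Lemma norm_scalar_conj (z : F) : `|theta z| = `|z|.
Proof. by case: k z => z //=; rewrite norm_conjC. Qed.

Definition scalar_sqrt : F -> F :=
  match k return Defs.scalar R k -> Defs.scalar R k with
  | RealScalars => fun x : R => Num.sqrt x
  | ComplexScalars => fun x : R[i] => sqrtC x
  end.

Lemma scalar_sqrt_ge0 (x : F) : 0 <= x -> 0 <= scalar_sqrt x.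
Proof.
by rewrite /scalar_sqrt; case: k x => x /= x0; rewrite ?sqrtr_ge0 ?sqrtC_ge0.
Qed.

Lemma sqr_scalar_sqrt (x : F) : 0 <= x -> scalar_sqrt x ^+ 2 = x.
Proof.
by rewrite /scalar_sqrt; case: k x => x /= x0; rewrite ?sqr_sqrtr ?sqrtCK.
Qed.

Lemma ler_sqr_scalar (x y : F) : 0 <= x -> 0 <= y -> x ^+ 2 <= y ^+ 2 -> x <= y.
Proof. by move=> x0 y0; rewrite ler_pXn2r. Qed.

(** The nonnegative scalars are closed, also in the partial order of R[i]: a
    limit of such scalars equals its own absolute value. *)
Lemma ge0_limit (c s : F) : 0 <= c ->
  (forall e, 0 < e -> e <= 1 -> exists2 r, 0 <= r & `|s - r| <= c * e) ->
  0 <= s.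
Proof.
move=> c0 H; suff -> : s = `|s| by [].
apply/eqP; rewrite -subr_eq0; apply/eqP.
apply: (@le_eps_eq0 _ _ _ (c + c)); first by rewrite addr_ge0.
move=> e e0 e1; have [r r0 sr] := H e e0 e1.
rewrite -(subrK r s) -addrA (le_trans (ler_normD _ _))// mulrDl lerD//.
rewrite -{1}(ger0_norm r0) subrK (le_trans (ler_dist_dist _ _))//.
by rewrite distrC.
Qed.

Lemma ger0_complexE (z : R[i]) : 0 <= z -> z = (complex.Re z)%:C%C.
Proof. by move=> z0; rewrite RRe_real ?ger0_real. Qed.

(** The nonnegative elements of R[i] are the real ones, so that infima over
    the complex scalars are computed on real parts. *)
Lemma scalar_inf (D : set F) : D !=set0 -> (forall x, D x -> 0 <= x) ->
  exists d, [/\ 0 <= d, forall x, D x -> d <= x &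
    forall e, 0 < e -> exists2 x, D x & x < d + e].
Proof.
have real_inf (B : set R) : B !=set0 -> (forall x, B x -> 0 <= x) ->
    exists d, [/\ 0 <= d, forall x, B x -> d <= x &
    forall e, 0 < e -> exists2 x, B x & x < d + e].
  move=> B0 Bge0; have hB : has_inf B by split=> //; exists 0 => x /Bge0.
  exists (inf B); split.
  - by apply: lb_le_inf => // x /Bge0.
  - by move=> x Bx; apply: ge_inf => //; case: hB.
  - by move=> e e0; have [x Bx] := inf_adherent e0 hB; exists x.
case: k D => D [x0 Dx0] Dge0; first by apply: real_inf => //; exists x0.
have [] := real_inf [set complex.Re z | z in D].
- by exists (complex.Re x0); exists x0.
- by move=> _ [z Dz <-]; rewrite -ler0c RRe_real ?ger0_real ?Dge0//; exact: Dge0.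
move=> d [d0 dD dinf]; exists (d%:C)%C; split.
- by rewrite ler0c.
- move=> z Dz; rewrite (ger0_complexE (Dge0 _ Dz)) lecR.
  by apply: dD; exists z.
- move=> e e0; have e0' := ger0_complexE (ltW e0).
  have [|_ [z Dz <-] ze] := dinf (complex.Re e).
    by rewrite -ltcR -e0'.
  exists z => //; rewrite (ger0_complexE (Dge0 _ Dz)) e0'.
  by rewrite -rmorphD/= ltcR.
Qed.

(** Over R[i] the real and the imaginary parts have limits by the real case. *)
Lemma scalar_has_limits : has_limits (F : normedZmodType F).
Proof.
have RL : has_limits (R : normedZmodType R) := @complete_has_limits R R.
case: k => //= P P_ex P_close.
have part (f : {additive R[i] -> R}) : (forall z, `|f z|%:C%C <= `|z|) ->
    exists p, forall e z, 0 < e -> P e z -> `|f z - p|%:C%C <= e.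
  move=> f_le.
  have [e e0||p Pp] := RL (fun e x => exists2 z, P e%:C%C z & x = f z).
  - by have [|z Pz] := P_ex e%:C%C; [rewrite ltcR|exists (f z), z].
  - move=> e e' _ _ e0 e'0 [z Pz ->] [w Pw ->].
    rewrite -raddfB -lecR (le_trans (f_le _))// rmorphD/=.
    by apply: P_close => //; rewrite ltcR.
  exists p => e z e0 Pz; have eE := ger0_complexE (ltW e0).
  by rewrite eE lecR Pp//; [rewrite -ltcR -eE|exists z; rewrite -?eE].
have [a Pa] := part (@complex.Re R : {additive R[i] -> R}) (@normc_ge_Re R).
have Im_le (z : R[i]) : `|complex.Im z|%:C%C <= `|z|.
  have -> : complex.Im z = complex.Re (- ('i%C * z)).
    by case: z => x y /=; rewrite mul0r mul1r add0r opprK.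
  rewrite (le_trans (normc_ge_Re _))// normrN normrM.
  by rewrite -[X in _ <= X]mul1r complexiE normCi.
have [b Pb] := part (@complex.Im R : {additive R[i] -> R}) Im_le.
(* Adding the errors of both parts loses a factor 2, which a second, much
     finer approximation w removes below. *)
have key e z : 0 < e -> P e z -> `|z - (a +i* b)%C| <= e + e.
  move=> e0 Pz; rewrite [z - _]complexE.
  rewrite (le_trans (ler_normD _ _))// normrM complexiE normCi mul1r.
  rewrite lerD//.
    by rewrite normc_def/= expr0n addr0 sqrtr_sqr raddfB; apply: Pa.
  by rewrite normc_def/= expr0n addr0 sqrtr_sqr raddfB; apply: Pb.
exists (a +i* b)%C => e z e0 Pz; apply: (@ler_addeps _ 3) => // [|d d0 _].
  exact: ltW.
have [w Pw] := P_ex _ d0.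
rewrite -(subrK w z) -addrA (le_trans (ler_normD _ _))//.
rewrite (le_trans (lerD (P_close _ _ _ _ e0 d0 Pz Pw) (key _ _ d0 Pw)))//.
by rewrite -addrA lerD2l le_eqVlt; apply/orP; left; apply/eqP; ring.
Qed.

End Scalars.

(** * Semi-inner products *)

(** The carrier is a bare type because the leading example consists of lists,
    read as formal finite sums: addition is concatenation, and the laws of a
    module hold only up to vectors of norm 0. *)
Record semi_inner (R : realType) (k : scalar_kind) := SemiInner {
  si_sort :> Type;
  si_zero : si_sort;
  si_add : si_sort -> si_sort -> si_sort;
  si_scale : Defs.scalar R k -> si_sort -> si_sort;
  si_form : si_sort -> si_sort -> Defs.scalar R k;
  si_form0l : forall w, si_form si_zero w = 0;
  si_formDl : forall u v w,
    si_form (si_add u v) w = si_form u w + si_form v w;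
  si_formZl : forall c u w, si_form (si_scale c u) w = c * si_form u w;
  si_formC : forall u v, si_form u v = scalar_conj R k (si_form v u);
  si_form_ge0 : forall u, 0 <= si_form u u
}.

Section SemiInnerTheory.
Variables (R : realType) (k : scalar_kind) (V : semi_inner R k).
Local Notation F := (Defs.scalar R k).
Local Notation theta := (scalar_conj R k).
Local Notation B := (@si_form R k V).
Local Notation add := (@si_add R k V).
Local Notation scl := (@si_scale R k V).
Implicit Types (u v w : V) (c e : F).

Definition si_norm u : F := scalar_sqrt (B u u).

Lemma si_norm_ge0 u : 0 <= si_norm u.
Proof. exact/scalar_sqrt_ge0/si_form_ge0. Qed.

Lemma si_normE u : si_norm u ^+ 2 = B u u.
Proof. exact/sqr_scalar_sqrt/si_form_ge0. Qed.

Hint Resolve si_norm_ge0 : core.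

Lemma si_formDr u v w : B u (add v w) = B u v + B u w.
Proof. by rewrite si_formC si_formDl rmorphD -!si_formC. Qed.

Lemma si_formZr c u v : B u (scl c v) = theta c * B u v.
Proof. by rewrite si_formC si_formZl rmorphM -si_formC. Qed.

(** With t = <v, v> + e, the form is nonnegative at t u - <u, v> v; adding e
    avoids the case <v, v> = 0. *)
Lemma si_CauchySchwarz_sqr u v : `|B u v| ^+ 2 <= B u u * B v v.
Proof.
apply: (@ler_addeps _ (B u u)) => [|||e e0 _].
- by rewrite exprn_ge0.
- by rewrite mulr_ge0 ?si_form_ge0.
- exact: si_form_ge0.
rewrite -mulrDr; set t := B v v + e.
have t0 : 0 < t by rewrite ltr_wpDl ?si_form_ge0.
have tc : theta t = t by rewrite ger0_scalar_conj// ltW.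
have := si_form_ge0 (add (scl t u) (scl (- B u v) v)).
rewrite !(si_formDl, si_formDr, si_formZl, si_formZr) rmorphN tc.
rewrite [B v u]si_formC => H.
rewrite -(ler_pM2l t0) -subr_ge0; apply: le_trans H _.
have -> : t * (t * B u u) + t * (- theta (B u v) * B u v) +
    (- B u v * (t * theta (B u v)) + - B u v * (- theta (B u v) * B v v)) =
    t * (t * B u u) - (t + t - B v v) * (B u v * theta (B u v)) by ring.
rewrite mul_scalar_conj mulrCA [B u u * t]mulrC lerD2l lerN2.
by rewrite ler_wpM2r ?exprn_ge0// -addrA lerDl subr_ge0 lerDl ltW.
Qed.

Lemma si_CauchySchwarz u v : `|B u v| <= si_norm u * si_norm v.
Proof.
by rewrite ler_sqr_scalar ?mulr_ge0// exprMn !si_normE si_CauchySchwarz_sqr.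
Qed.

Lemma si_normD u v : si_norm (add u v) <= si_norm u + si_norm v.
Proof.
rewrite ler_sqr_scalar ?addr_ge0// si_normE !(si_formDl, si_formDr).
have -> : (si_norm u + si_norm v) ^+ 2 =
    si_norm u ^+ 2 + si_norm u * si_norm v
      + (si_norm u * si_norm v + si_norm v ^+ 2) by ring.
rewrite !si_normE -!addrA lerD2l !addrA lerD2r.
have re : B v u + B u v \is Num.real.
  have := si_form_ge0 (add u v); rewrite !(si_formDl, si_formDr) => /ger0_real re.
  have -> : B v u + B u v = B u u + B u v + (B v u + B v v) - B u u - B v v by ring.
  apply: realB; last exact/ger0_real/si_form_ge0.
  by apply: realB; last exact/ger0_real/si_form_ge0.
rewrite addrC (le_trans (real_ler_norm _))// 1?addrC//.
rewrite (le_trans (ler_normD _ _))// lerD ?si_CauchySchwarz// mulrC.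
exact: si_CauchySchwarz.
Qed.

Lemma si_normZ c u : si_norm (scl c u) = `|c| * si_norm u.
Proof.
apply/eqP; rewrite -(eqrXn2 (n := 2)) ?mulr_ge0// si_normE si_formZl si_formZr.
by rewrite exprMn mulrA mul_scalar_conj si_normE.
Qed.

End SemiInnerTheory.

(** * Completion of a semi-inner product *)

Section Completion.
Variables (R : realType) (k : scalar_kind) (V : semi_inner R k).
Local Notation F := (Defs.scalar R k).
Local Notation theta := (scalar_conj R k).
Local Notation B := (@si_form R k V).
Local Notation nrm := (@si_norm R k V).
Implicit Types (u v w : V) (c e C : F).

(** The functional f and the functional given by v are at distance at most e
    in the dual norm. *)
Definition represents (f : V -> F) e v : Prop :=
  forall w, `|f w - B v w| <= e * nrm w.

Definition approximable : {pred V -> F} :=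
  fun f => `[< forall e, 0 < e -> exists v, represents f e v >].

Let nrm0 v : 0 <= nrm v := si_norm_ge0 v.
Local Hint Resolve nrm0 : core.

Lemma approximable_submod : submod_closed approximable.
Proof.
split=> [|c f g /asboolP fA /asboolP gA]; apply/asboolP => e e0.
  exists (si_zero V) => w; rewrite si_form0l subrr normr0.
  by rewrite mulr_ge0// ltW.
have c1 : 0 < `|c| + 1 by rewrite ltr_wpDl.
have d0 : 0 < e / (`|c| + 1) by rewrite divr_gt0.
have [[v fv] [v' gv]] := (fA _ d0, gA _ d0).
exists (si_add (si_scale c v) v') => w.
rewrite si_formDl si_formZl -[(c *: f + g) w]/(c * f w + g w).
have -> : c * f w + g w - (c * B v w + B v' w) =
  c * (f w - B v w) + (g w - B v' w) by ring.
rewrite (le_trans (ler_normD _ _))// normrM.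
rewrite (le_trans (lerD (ler_wpM2l _ (fv w)) (gv w)))//.
rewrite le_eqVlt; apply/orP; left; apply/eqP.
set d := e / _; have -> : `|c| * (d * nrm w) + d * nrm w =
  d * (`|c| + 1) * nrm w by ring.
by rewrite /d divfK// gt_eqF.
Qed.

HB.instance Definition _ :=
  GRing.isSubmodClosed.Build F (V -> F) approximable approximable_submod.

(** The completion is the norm closure of V in its antidual.  Its vectors are
    functions on V, so that no quotient is needed and vectors are compared
    pointwise. *)
Record completion := Completion {
  completion_fun :> V -> F;
  _ : completion_fun \in approximable
}.
HB.instance Definition _ := [isSub for completion_fun].
HB.instance Definition _ := [Choice of completion by <:].
HB.instance Definition _ := [SubChoice_isSubLmodule of completion by <:].

Implicit Types f g : completion.

Lemma completion_approx f e : 0 < e -> exists v, represents f e v.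
Proof. by case: f => f /= /asboolP; apply. Qed.

Lemma completionP f g : (forall w, f w = g w) -> f = g.
Proof. by move=> fg; apply: val_inj; apply/funext. Qed.

Lemma completionDE f g w : (f + g) w = f w + g w. Proof. by []. Qed.
Lemma completionZE c f w : (c *: f) w = c * f w. Proof. by []. Qed.
Lemma completionBE f g w : (f - g) w = f w - g w. Proof. by []. Qed.

Definition bounded_by f C : Prop := forall w, `|f w| <= C * nrm w.

Lemma completion_bounded f : exists2 C, 0 < C & bounded_by f C.
Proof.
have [v fv] := completion_approx f ltr01.
exists (nrm v + 1) => [|w]; first by rewrite ltr_wpDl.
rewrite -[f w](subrK (B v w)) (le_trans (ler_normD _ _))//.
by rewrite addrC mulrDl lerD// si_CauchySchwarz.
Qed.

Lemma completionD f v w : f (si_add v w) = f v + f w.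
Proof.
apply/eqP; rewrite -subr_eq0; apply/eqP.
apply: (@le_eps_eq0 _ _ _ (nrm (si_add v w) + nrm v + nrm w)).
  by rewrite !addr_ge0.
move=> e e0 _; have [u fu] := completion_approx f e0.
have -> : f (si_add v w) - (f v + f w) =
    (f (si_add v w) - B u (si_add v w)) - (f v - B u v) - (f w - B u w).
  by rewrite si_formDr; ring.
rewrite (le_trans (ler_normB _ _))// !mulrDl lerD//; last first.
  by rewrite mulrC; exact: fu.
by rewrite (le_trans (ler_normB _ _))// ![nrm _ * _]mulrC lerD//; exact: fu.
Qed.

Lemma completionZ f c w : f (si_scale c w) = theta c * f w.
Proof.
apply/eqP; rewrite -subr_eq0; apply/eqP.
apply: (@le_eps_eq0 _ _ _ (nrm (si_scale c w) + `|theta c| * nrm w)).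
  by rewrite !addr_ge0 ?mulr_ge0.
move=> e e0 _; have [u fu] := completion_approx f e0.
have -> : f (si_scale c w) - theta c * f w =
    (f (si_scale c w) - B u (si_scale c w)) - theta c * (f w - B u w).
  by rewrite si_formZr; ring.
rewrite (le_trans (ler_normB _ _))// mulrDl lerD//.
  by rewrite mulrC; exact: fu.
by rewrite normrM -mulrA ler_wpM2l// mulrC; exact: fu.
Qed.

Definition si_sub v w : V := si_add v (si_scale (-1) w).

Lemma completionB f v w : f (si_sub v w) = f v - f w.
Proof. by rewrite completionD completionZ rmorphN1 mulN1r. Qed.

Lemma si_formBl u v w : B (si_sub u v) w = B u w - B v w.
Proof. by rewrite si_formDl si_formZl mulN1r. Qed.

Lemma si_norm_le v c : 0 <= c -> B v v <= c * nrm v -> nrm v <= c.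
Proof.
move=> c0; rewrite -si_normE expr2.
have [->|v0] := eqVneq (nrm v) 0; first by rewrite mulr0.
by rewrite ler_pM2r// lt_neqAle eq_sym v0 nrm0.
Qed.

Lemma represents_close f e e' v v' : 0 <= e -> 0 <= e' ->
  represents f e v -> represents f e' v' -> nrm (si_sub v v') <= e + e'.
Proof.
move=> e0 e'0 fv fv'; apply: si_norm_le; first exact: addr_ge0.
set d := si_sub v v'.
rewrite -[B d d]ger0_norm ?si_form_ge0// {2}/d si_formBl.
have -> : B v d - B v' d = (f d - B v' d) - (f d - B v d) by ring.
by rewrite (le_trans (ler_normB _ _))// mulrDl addrC lerD.
Qed.

Lemma represents_norm f C e v : 0 <= C -> 0 <= e ->
  bounded_by f C -> represents f e v -> nrm v <= C + e.
Proof.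
move=> C0 e0 fC fv; apply: si_norm_le; first exact: addr_ge0.
rewrite -[B v v]ger0_norm ?si_form_ge0//.
have -> : B v v = f v - (f v - B v v) by ring.
by rewrite (le_trans (ler_normB _ _))// mulrDl lerD.
Qed.

Lemma bounded_close f C v v' e : bounded_by f C -> 0 <= C ->
  nrm (si_sub v v') <= e -> `|f v - f v'| <= C * e.
Proof.
by move=> fC C0 vv; rewrite -completionB (le_trans (fC _))// ler_wpM2l.
Qed.

(** A functional f extends continuously to the completion; s is its value
    at g, approached by f v for v close to g. *)
Lemma dot_exists f g : exists s, forall e v C, 0 <= e -> represents g e v ->
  0 <= C -> bounded_by f C -> `|f v - s| <= C * e.
Proof.
have [C C0 fC] := completion_bounded f.
pose P e s := exists v d, [/\ 0 < d, C * d <= e, represents g d v & s = f v].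
have [e e0|e e' s s' e0 e'0 [v [d [d0 de gv ->]]] [v' [d' [d'0 de' gv' ->]]]|s Ps]
    := @scalar_has_limits R k P.
- have d0 : 0 < e / C by rewrite divr_gt0.
  have [v gv] := completion_approx g d0.
  exists (f v), v, (e / C); split=> //.
  by rewrite mulrC divfK ?gt_eqF.
- rewrite (le_trans (bounded_close fC (ltW C0)
    (represents_close (ltW d0) (ltW d'0) gv gv')))//.
  by rewrite mulrDr lerD.
exists s => e v C' e0 gv C'0 fC'.
apply: (@ler_addeps _ (C' + C)); rewrite ?mulr_ge0 ?addr_ge0 ?(ltW C0)//.
move=> d d0 _; have [v' gv'] := completion_approx g d0.
rewrite -(subrK (f v') (f v)) -addrA (le_trans (ler_normD _ _))//.
rewrite mulrDl addrA lerD//.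
  rewrite -mulrDr bounded_close//.
  by apply: represents_close gv gv' => //; exact: ltW.
by apply: Ps; [rewrite mulr_gt0|exists v', d].
Qed.

Definition completion_dot f g : F := projT1 (cid (dot_exists f g)).

Lemma completion_dotP f g e v C : 0 <= e -> represents g e v ->
  0 <= C -> bounded_by f C -> `|f v - completion_dot f g| <= C * e.
Proof. by rewrite /completion_dot; case: cid => /= s H; apply: H. Qed.

Lemma completion_dotDl f f' g :
  completion_dot (f + f') g = completion_dot f g + completion_dot f' g.
Proof.
have [C C0 fC] := completion_bounded f.
have [C' C'0 fC'] := completion_bounded f'.
have [D D0 fD] := completion_bounded (f + f').
apply/esym/eqP; rewrite -subr_eq0; apply/eqP.
apply: (@le_eps_eq0 _ _ _ (D + C + C')); first by rewrite !addr_ge0 ?ltW.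
move=> e e0 _; have [v gv] := completion_approx g e0.
have -> : completion_dot f g + completion_dot f' g - completion_dot (f + f') g =
  ((f + f') v - completion_dot (f + f') g) - (f v - completion_dot f g)
    - (f' v - completion_dot f' g) by rewrite completionDE; ring.
rewrite (le_trans (ler_normB _ _))// !mulrDl lerD//.
  rewrite (le_trans (ler_normB _ _))// lerD//; apply: completion_dotP => //; exact: ltW.
by apply: completion_dotP => //; exact: ltW.
Qed.

Lemma completion_dotZl c f g :
  completion_dot (c *: f) g = c * completion_dot f g.
Proof.
have [C C0 fC] := completion_bounded f.
have [D D0 fD] := completion_bounded (c *: f).
apply/esym/eqP; rewrite -subr_eq0; apply/eqP.
apply: (@le_eps_eq0 _ _ _ (D + `|c| * C)).
  by rewrite addr_ge0 ?mulr_ge0 ?(ltW D0) ?(ltW C0).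
move=> e e0 _; have [v gv] := completion_approx g e0.
have -> : c * completion_dot f g - completion_dot (c *: f) g =
  ((c *: f) v - completion_dot (c *: f) g) - c * (f v - completion_dot f g)
  by rewrite completionZE; ring.
rewrite (le_trans (ler_normB _ _))// mulrDl lerD//.
  by apply: completion_dotP => //; exact: ltW.
rewrite normrM -mulrA ler_wpM2l//.
by apply: completion_dotP => //; exact: ltW.
Qed.

(** The definition of the inner product treats its two arguments differently;
    this symmetric description yields hermitian symmetry and positivity. *)
Lemma completion_dot_approx f g :
  exists2 C, 0 <= C & forall e u v, 0 < e -> e <= 1 ->
  represents f e u -> represents g e v ->
  `|completion_dot f g - B u v| <= C * e.
Proof.
have [C C0 fC] := completion_bounded f.
have [D D0 gD] := completion_bounded g.
exists (C + (D + 1)); first by rewrite !addr_ge0 ?ltW.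
move=> e u v e0 e1 fu gv.
rewrite -(subrK (f v) (completion_dot f g)) -addrA (le_trans (ler_normD _ _))//.
rewrite mulrDl lerD//.
  by rewrite distrC; apply: completion_dotP => //; exact: ltW.
rewrite (le_trans (fu v))// mulrC ler_wpM2r ?(ltW e0)//.
apply: le_trans (represents_norm _ _ gD gv) _; rewrite ?(ltW D0) ?(ltW e0)//.
by rewrite lerD2l.
Qed.

Lemma completion_dotC f g : completion_dot f g = theta (completion_dot g f).
Proof.
have [C C0 fgC] := completion_dot_approx f g.
have [D D0 gfD] := completion_dot_approx g f.
apply/eqP; rewrite -subr_eq0; apply/eqP.
apply: (@le_eps_eq0 _ _ _ (C + D)); first by rewrite addr_ge0.
move=> e e0 e1; have [u fu] := completion_approx f e0.
have [v gv] := completion_approx g e0.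
have -> : completion_dot f g - theta (completion_dot g f) =
    (completion_dot f g - B u v) - theta (completion_dot g f - B v u).
  by rewrite rmorphB -si_formC; ring.
by rewrite (le_trans (ler_normB _ _))// norm_scalar_conj mulrDl lerD ?fgC ?gfD.
Qed.

Lemma completion_dot_ge0 f : 0 <= completion_dot f f.
Proof.
have [C C0 fC] := completion_dot_approx f f.
apply: (ge0_limit C0) => e e0 e1; have [u fu] := completion_approx f e0.
by exists (B u u); [exact: si_form_ge0|exact: fC].
Qed.

Lemma completion_dot0l g : completion_dot 0 g = 0.
Proof. by rewrite -(scale0r 0) completion_dotZl mul0r. Qed.

(** Viewing the completion as a semi-inner product itself provides the
    Cauchy-Schwarz and triangle inequalities before any norm is declared. *)
Definition completion_form : semi_inner R k :=
  SemiInner completion_dot0l completion_dotDl completion_dotZl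
    completion_dotC completion_dot_ge0.

Definition completion_norm f : F := si_norm (f : completion_form).

Lemma embed_approximable v : (fun w => B v w) \in approximable.
Proof.
apply/asboolP => e e0; exists v => w.
by rewrite subrr normr0 mulr_ge0// ltW.
Qed.

Definition embed v : completion := Completion (embed_approximable v).

Lemma embed_represents v : represents (embed v) 0 v.
Proof. by move=> w /=; rewrite subrr normr0 mul0r. Qed.

Lemma dot_embedr f w : completion_dot f (embed w) = f w.
Proof.
have [C C0 fC] := completion_bounded f.
have := completion_dotP (lexx 0) (embed_represents w) (ltW C0) fC.
by rewrite mulr0 normr_le0 subr_eq0 => /eqP.
Qed.

Lemma completion_norm_embed w : completion_norm (embed w) = nrm w.
Proof. by rewrite /completion_norm /si_norm /= dot_embedr. Qed.

(** Together with the next lemma: the Hilbert norm is the dual norm. *)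
Lemma completion_norm_bound f : bounded_by f (completion_norm f).
Proof.
move=> w; rewrite -dot_embedr -completion_norm_embed.
exact: (@si_CauchySchwarz _ _ completion_form f (embed w)).
Qed.

Lemma completion_norm_le f C : 0 <= C -> bounded_by f C -> completion_norm f <= C.
Proof.
move=> C0 fC; apply: ler_sqr_scalar => //; first exact: si_norm_ge0.
rewrite si_normE /=; apply: (@ler_addeps _ (C + C)).
- exact: completion_dot_ge0.
- by rewrite exprn_ge0.
- by rewrite addr_ge0.
move=> e e0 _; have [v fv] := completion_approx f e0.
rewrite -[completion_dot f f]ger0_norm ?completion_dot_ge0//.
rewrite -(subrK (f v) (completion_dot f f)) (le_trans (ler_normD _ _))//.
rewrite expr2 mulrDl addrA addrC lerD//.
  by rewrite distrC completion_dotP// ltW.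
rewrite (le_trans (fC v))// -mulrDr ler_wpM2l//.
by apply: represents_norm fC fv => //; exact: ltW.
Qed.

Lemma completion_norm_eq0 f : completion_norm f = 0 -> f = 0.
Proof.
move=> f0; apply: completionP => w; apply/eqP; rewrite -normr_le0.
by rewrite (le_trans (completion_norm_bound f w))// f0 mul0r.
Qed.

Lemma completion_normD f g :
  completion_norm (f + g) <= completion_norm f + completion_norm g.
Proof. exact: (@si_normD _ _ completion_form). Qed.

Lemma completion_normZ c f :
  completion_norm (c *: f) = `|c| * completion_norm f.
Proof. exact: (@si_normZ _ _ completion_form). Qed.

HB.instance Definition _ := Lmodule_isNormed.Build F completion
  completion_normD completion_normZ completion_norm_eq0.

(** Limits are taken pointwise.  The dual norm turns uniform control of the
    values at all w into control of the norm. *)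
Lemma completion_has_limits : has_limits (completion : normedZmodType F).
Proof.
move=> P P_ex P_close.
have lim w : exists p, forall e f, 0 < e -> P e f -> `|f w - p| <= e * nrm w.
  pose Q d s := exists e f, [/\ 0 < e, P e f, e * nrm w <= d & s = f w].
  have w1 : 0 < nrm w + 1 by rewrite ltr_wpDl.
  have [d d0|d d' s s' d0 d'0 [e [f [e0 Pf ed ->]]] [e' [f' [e'0 Pf' ed' ->]]]|p Qp]
      := @scalar_has_limits R k Q.
  - have e0 : 0 < d / (nrm w + 1) by rewrite divr_gt0.
    have [f Pf] := P_ex _ e0.
    exists (f w), (d / (nrm w + 1)), f; split=> //.
    by rewrite mulrAC ler_pdivrMr// ler_pM2l// lerDl.
  - rewrite -completionBE (le_trans (completion_norm_bound _ _))//.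
    rewrite (le_trans _ (lerD ed ed'))// -mulrDl ler_wpM2r//.
    exact: P_close Pf Pf'.
  exists p => e f e0 Pf; apply: (@ler_addeps _ 1) => // [|d d0 _].
    by rewrite mulr_ge0// ltW.
  rewrite mul1r; apply: Qp; first by rewrite ltr_wpDl// mulr_ge0// ltW.
  by exists e, f; split=> //; rewrite lerDl ltW.
have [p Pp] := choice lim.
(* An e / 2 - approximation of p, approximated in V in its turn up to e / 2. *)
have pA : p \in approximable.
  apply/asboolP => e e0; have e2 : 0 < e / 2 by rewrite divr_gt0.
  have [f Pf] := P_ex _ e2; have [v fv] := completion_approx f e2.
  exists v => w; rewrite -(subrK (f w) (p w)) -addrA (le_trans (ler_normD _ _))//.
  rewrite [e in leRHS]splitr.
  by rewrite mulrDl lerD ?fv// distrC Pp.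
exists (Completion pA) => e f e0 Pf.
apply: completion_norm_le; first exact: ltW.
by move=> w; rewrite completionBE; exact: Pp.
Qed.

Lemma completion_complete (Q : set_system completion) :
  ProperFilter Q -> cauchy Q -> cvg Q.
Proof.
move=> QF /cauchyP Qc.
pose P e f := Q (ball (f : completion) (e : F)).
have [e e0|e e' f f' e0 e'0 Pf Pf'|p Pp] := completion_has_limits (P := P).
- by have [f Qf] := Qc e e0; exists f.
- have [h []] := filter_ex (filterI Pf Pf').
  rewrite -ball_normE /ball_ /= => fh f'h.
  rewrite -(subrK h f) -addrA (le_trans (ler_normD _ _))// lerD// ?ltW//.
  by rewrite distrC.
apply/cvg_ex; exists p; apply/fcvgrPdist_lt => e e0.
have e2 : 0 < e / 2 by rewrite divr_gt0.
have [f Qf] := Qc _ e2.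
have Pf : P (e / 2) f := Qf.
apply: filterS Qf => h; rewrite -ball_normE /ball_ /= => fh.
rewrite -(subrK f p) -addrA (le_lt_trans (ler_normD _ _))//.
rewrite [e](splitr e) ler_ltD//.
by rewrite distrC; exact: Pp.
Qed.

HB.instance Definition _ :=
  Uniform_isComplete.Build completion completion_complete.

Lemma completion_dot_linearl g : linear_for *%R (completion_dot^~ g).
Proof. by move=> c f f'; rewrite completion_dotDl completion_dotZl. Qed.

Lemma completion_dot_linearr f :
  linear_for (theta \; *%R) (completion_dot f).
Proof.
by move=> c g g'; rewrite !(completion_dotC f) completion_dotDl completion_dotZl
  rmorphD rmorphM.
Qed.

HB.instance Definition _ := @bilinear_isBilinear.Build F completion completion F
  *%R (theta \; *%R) completion_dot
  (completion_dot_linearl, completion_dot_linearr).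

Lemma completion_dot_hermitian f g :
  completion_dot f g = (-1) ^+ false * theta (completion_dot g f).
Proof. by rewrite expr0 mul1r -completion_dotC. Qed.

HB.instance Definition _ := @isHermitianSesquilinear.Build F completion false
  theta completion_dot completion_dot_hermitian.

Lemma completion_dot_gt0 f : f != 0 -> 0 < completion_dot f f.
Proof.
move=> f0; rewrite lt_neqAle completion_dot_ge0 andbT eq_sym.
apply: contra_neq f0 => ff; apply: completion_norm_eq0.
have := @si_normE _ _ completion_form f; rewrite /= ff => /eqP.
by rewrite sqrf_eq0 => /eqP.
Qed.

HB.instance Definition _ :=
  @isDotProduct.Build F completion completion_dot completion_dot_gt0.

Lemma completion_dot_norm f : completion_dot f f = `|f| ^+ 2.
Proof. by rewrite [RHS](@si_normE _ _ completion_form). Qed.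

Definition completion_hilbert : hilbert R k :=
  @Hilbert R k completion completion_dot completion_dot_norm.

End Completion.

(** * Density, extension and projection in Hilbert spaces *)

Section HilbertTheory.
Variables (R : realType) (k : scalar_kind).
Local Notation F := (Defs.scalar R k).
Local Notation theta := (scalar_conj R k).
Implicit Types (E W : hilbert R k).

Lemma dotpC E (u v : E) : dotp E u v = theta (dotp E v u).
Proof. by rewrite hermC expr0 mul1r. Qed.

Lemma dotp_ge0 E (u : E) : 0 <= dotp E u u.
Proof. by rewrite dotp_norm exprn_ge0. Qed.

(** This view makes the Cauchy-Schwarz inequality above available in Hilbert
    spaces. *)
Definition hilbert_form E : semi_inner R k :=
  @SemiInner R k E 0 +%R *:%R (dotp E) (@linear0l _ _ _ _ _ _ (dotp E))
    (fun u v w => linearDl (dotp E) w u v)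
    (fun c u w => linearZl_LR (dotp E) w c u) (@dotpC E) (@dotp_ge0 E).

Lemma hilbert_formE E (u : E) : si_norm (u : hilbert_form E) = `|u|.
Proof.
apply/eqP; rewrite -(eqrXn2 (n := 2)) ?si_norm_ge0//.
by rewrite si_normE /= dotp_norm.
Qed.

Lemma dotp_CauchySchwarz E (u v : E) : `|dotp E u v| <= `|u| * `|v|.
Proof.
by rewrite -!hilbert_formE (@si_CauchySchwarz _ _ (hilbert_form E) u v).
Qed.

Lemma dotp_inj E (u : E) : (forall v, dotp E u v = 0) -> u = 0.
Proof.
by move=> /(_ u)/eqP; rewrite dotp_norm expf_eq0 /= normr_eq0 => /eqP.
Qed.

(** The parallelogram law, solved for the difference. *)
Lemma parallelogram E (x y : E) :
  `|x - y| ^+ 2 = 2 * `|x| ^+ 2 + 2 * `|y| ^+ 2 - `|x + y| ^+ 2.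
Proof. by rewrite -!dotp_norm hnormB hnormD; ring. Qed.

Lemma bounded_op_bound E W (T : bounded_op E W) :
  exists2 M, 0 <= M & forall v, `|T v| <= M * `|v|.
Proof.
have [M TM] := bounded_opP T; exists `|M| => // v.
have Mv0 : 0 <= M * `|v| by rewrite (le_trans _ (TM v)).
by rewrite -[`|v|]normr_id -normrM ger0_norm.
Qed.

Lemma bounded_op_ext E W (S T : bounded_op E W) : (forall v, S v = T v) -> S = T.
Proof.
case: S T => [S SM] [T TM] /= ST.
have ST' : S = T :> {linear E -> W}.
  case: S T {SM TM} ST => [S [[S1] [S2]]] [T [[T1] [T2]]] /= /funext ST.
  move: S1 S2 T1 T2; rewrite ST => *.
  by congr GRing.Linear.Pack; congr GRing.Linear.Class; congr (_ _); apply: Prop_irrelevance.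
by move: SM TM; rewrite ST' => SM TM; congr BoundedOp; exact: Prop_irrelevance.
Qed.

Lemma bounded_op_exists E W (f : E -> W) M : linear f ->
  (forall v, `|f v| <= M * `|v|) ->
  exists T : bounded_op E W, forall v, T v = f v.
Proof.
move=> f_lin fM.
pose L := GRing.isLinear.Build F E W *:%R f f_lin.
pose fL : {linear E -> W} := HB.pack f L.
have fL_bounded : exists M, forall v, `|fL v| <= M * `|v| by exists M.
by exists (BoundedOp fL_bounded).
Qed.

(** Plain sums suffice to express density of the span, because the families in
    use are closed under scaling. *)
Definition total_family E (Z : Type) (e : Z -> E) : Prop :=
  forall v (d : F), 0 < d -> exists l : seq Z, `|v - \sum_(z <- l) e z| <= d.

(** Stated for additive maps, to apply to inner products in either argument,
    the conjugate-linear one included. *)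
Lemma total_family_eq0 E (W : normedZmodType F) (Z : Type) (e : Z -> E)
    (phi : E -> W) (C : F) : total_family e -> 0 <= C ->
  {morph phi : u v / u + v} -> (forall v, `|phi v| <= C * `|v|) ->
  (forall z, phi (e z) = 0) -> forall v, phi v = 0.
Proof.
move=> e_tot C0 phiD phiC phi0 v.
have phi_0 : phi 0 = 0 by apply: (addrI (phi 0)); rewrite -phiD !addr0.
apply: (@le_eps_eq0 _ _ _ C) => // d d0 _; have [l vl] := e_tot v d d0.
have phil : phi (\sum_(z <- l) e z) = 0.
  by elim/big_ind: _ => // a b a0 b0; rewrite phiD a0 b0 addr0.
rewrite -[v](subrK (\sum_(z <- l) e z)) phiD phil addr0.
exact: le_trans (phiC _) (ler_wpM2l C0 vl).
Qed.

Lemma total_family_op_eq E W (Z : Type) (e : Z -> E) (S T : bounded_op E W) :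
  total_family e -> (forall z, S (e z) = T (e z)) -> forall v, S v = T v.
Proof.
move=> e_tot ST v; apply/eqP; rewrite -subr_eq0; apply/eqP; move: v.
have [M M0 SM] := bounded_op_bound S; have [N N0 TN] := bounded_op_bound T.
apply: (@total_family_eq0 _ _ _ _ (fun v => S v - T v) (M + N) e_tot).
- exact: addr_ge0.
- by move=> u v; rewrite [S _]linearD [T _]linearD opprD addrACA.
- by move=> v; rewrite mulrDl (le_trans (ler_normB _ _))// lerD.
- by move=> z; rewrite ST subrr.
Qed.

Lemma total_family_orthogonal E (Z : Type) (e : Z -> E) (v : E) :
  total_family e -> (forall z, dotp E v (e z) = 0) -> v = 0.
Proof.
move=> e_tot ve; apply: dotp_inj.
apply: (@total_family_eq0 _ _ _ _ (dotp E v) `|v| e_tot) => //=.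
  by move=> a b; rewrite linearDr.
by move=> w; exact: dotp_CauchySchwarz.
Qed.

Lemma total_family_adjoint E W (Z Z' : Type) (e : Z -> E) (w : Z' -> W)
    (T : bounded_op E W) (S : bounded_op W E) :
  total_family e -> total_family w ->
  (forall z z', dotp W (T (e z)) (w z') = dotp E (e z) (S (w z'))) ->
  is_adjoint T S.
Proof.
move=> e_tot w_tot TS.
have [M M0 TM] := bounded_op_bound T; have [N N0 SN] := bounded_op_bound S.
have Tw z' u : dotp W (T u) (w z') = dotp E u (S (w z')).
  apply/eqP; rewrite -subr_eq0; apply/eqP; move: u.
  apply: (@total_family_eq0 _ _ _ _ _ (M * `|w z'| + `|S (w z')|) e_tot) => [|u v|v|z].
  - by rewrite addr_ge0 ?mulr_ge0.
  - by rewrite [T _]linearD !linearDl opprD addrACA.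
  - rewrite (le_trans (ler_normB _ _))// mulrDl lerD//.
      rewrite (le_trans (dotp_CauchySchwarz _ _))// mulrAC.
      by rewrite ler_wpM2r.
    by rewrite (le_trans (dotp_CauchySchwarz _ _))// mulrC.
  - by rewrite TS subrr.
move=> u; move=> v; apply/eqP; rewrite -subr_eq0; apply/eqP; move: v.
apply: (@total_family_eq0 _ _ _ _ _ (`|T u| + N * `|u|) w_tot) => [|a b|v|z].
- by rewrite addr_ge0 ?mulr_ge0.
- by rewrite [S _]linearD !linearDr opprD addrACA.
- rewrite (le_trans (ler_normB _ _))// mulrDl lerD//.
    by rewrite (le_trans (dotp_CauchySchwarz _ _)).
  by rewrite (le_trans (dotp_CauchySchwarz _ _))// mulrC mulrAC ler_wpM2r.
- by rewrite Tw subrr.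
Qed.

Lemma hilbert_has_limits E : has_limits (E : normedZmodType F).
Proof. exact: complete_has_limits. Qed.

Section Families.
Variables (E : hilbert R k) (Z : Type) (e : Z -> E) (sc : F -> Z -> Z).
Hypothesis e_sc : forall c z, e (sc c z) = c *: e z.
Local Notation S l := (\sum_(z <- l) e z).

Lemma sum_familyZ c l : c *: S l = S [seq sc c z | z <- l].
Proof. by rewrite scaler_sumr big_map; apply: eq_bigr => z _; rewrite e_sc. Qed.

Lemma sum_familyB l l' : S l - S l' = S (l ++ [seq sc (-1) z | z <- l']).
Proof. by rewrite big_cat/= -sum_familyZ scaleN1r. Qed.

(** Extension by continuity.  The value at v is the limit of the sums of w over
    the lists whose sums of e approach v. *)
Lemma extension W (w : Z -> W) (M : F) : total_family e -> 0 <= M ->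
  (forall c z, w (sc c z) = c *: w z) ->
  (forall l : seq Z, `|\sum_(z <- l) w z| <= M * `|S l|) ->
  exists2 T : bounded_op E W, forall z, T (e z) = w z &
    forall v, `|T v| <= M * `|v|.
Proof.
move=> e_tot M0 w_sc wM; pose Q l : W := \sum_(z <- l) w z.
have Qclose l l' : `|Q l - Q l'| <= M * `|S l - S l'|.
  rewrite sum_familyB (le_trans _ (wM _))// /Q big_cat/= big_map.
  by under [X in _ <= `|_ + X|]eq_bigr do rewrite w_sc scaleN1r; rewrite sumrN.
have lim v : exists p, forall l, `|Q l - p| <= M * `|S l - v|.
  pose P d q := exists2 l, M * `|S l - v| <= d & q = Q l.
  have [d d0|d d' _ _ d0 d'0 [l vl ->] [l' vl' ->]|p Pp] := @hilbert_has_limits W P.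
  - have M1 : 0 < M + 1 by rewrite ltr_wpDl.
    have [|l vl] := e_tot v (d / (M + 1)); first by rewrite divr_gt0.
    exists (Q l), l => //; rewrite distrC (le_trans (ler_wpM2l M0 vl))//.
    by rewrite mulrA ler_pdivrMr// [d * _]mulrC ler_pM2r// lerDl.
  - rewrite (le_trans (Qclose _ _))// (le_trans _ (lerD vl vl'))// -mulrDr.
    rewrite ler_wpM2l// (_ : S l - S l' = (S l - v) - (S l' - v)) ?ler_normB//.
    by rewrite opprB addrA subrK.
  exists p => l; apply: (@ler_addeps _ 1) => //; first by rewrite mulr_ge0.
  move=> d d0 _; rewrite mul1r; apply: Pp; first by rewrite ltr_wpDl// mulr_ge0.
  by exists l => //; rewrite lerDl ltW.
have [T TP] := choice lim.
(* The defining estimate TP determines T v, which makes T linear. *)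
have Tuniq v p C : 0 <= C ->
    (forall d, 0 < d -> exists2 l, `|S l - v| <= d & `|Q l - p| <= C * d) -> T v = p.
  move=> C0 H; apply/eqP; rewrite -subr_eq0; apply/eqP.
  apply: (@le_eps_eq0 _ _ _ (M + C)) => [|d d0 _]; first exact: addr_ge0.
  have [l vl pl] := H d d0.
  rewrite -(subrK (Q l) (T v)) -addrA (le_trans (ler_normD _ _))// mulrDl lerD//.
  by rewrite distrC (le_trans (TP v l))// ler_wpM2l.
have TM v : `|T v| <= M * `|v|.
  have := TP v [::]; rewrite /Q !big_nil !sub0r !normrN; exact.
have Tlin : linear T.
  move=> c u v; apply: (Tuniq _ _ M) => // d d0.
  have c1 : 0 < `|c| + 1 by rewrite ltr_wpDl.
  have d'0 : 0 < d / (`|c| + 1) by rewrite divr_gt0.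
  have [l ul] := e_tot u _ d'0; have [l' vl'] := e_tot v _ d'0.
  have dE : `|c| * (d / (`|c| + 1)) + d / (`|c| + 1) = d.
    by rewrite -{2}[d / _]mul1r -mulrDl mulrC divfK// gt_eqF.
  rewrite distrC in ul; rewrite distrC in vl'.
  have comb (W' : hilbert R k) (a a' b b' : W') (m : F) : 0 <= m ->
      `|a - a'| <= m * (d / (`|c| + 1)) -> `|b - b'| <= m * (d / (`|c| + 1)) ->
      `|c *: a + b - (c *: a' + b')| <= m * d.
    move=> m0 aa bb; rewrite opprD addrACA -scalerBr (le_trans (ler_normD _ _))//.
    by rewrite normrZ -dE mulrDr lerD// mulrCA ler_wpM2l.
  exists ([seq sc c z | z <- l] ++ l').
    by rewrite big_cat/= -sum_familyZ -[d]mul1r comb ?mul1r.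
  have -> : Q ([seq sc c z | z <- l] ++ l') = c *: Q l + Q l'.
    rewrite /Q big_cat/= big_map scaler_sumr; congr (_ + _).
    by apply: eq_bigr => z _; rewrite w_sc.
  by apply: comb => //; rewrite (le_trans (TP _ _))// ler_wpM2l.
have [T' T'E] := bounded_op_exists Tlin TM.
exists T' => [z|v]; rewrite T'E//.
apply: (Tuniq _ _ 0) => // d d0; exists [:: z]; rewrite /Q !big_seq1 subrr normr0 ?mul0r//.
exact: ltW.
Qed.

(** The projection theorem: the point p of the closed span nearest to v leaves
    a difference v - p that is orthogonal to the family. *)
Lemma total_family_of_orthogonal :
  (forall v, (forall z, dotp E v (e z) = 0) -> v = 0) -> total_family e.
Proof.
move=> e_orth v.
pose D := [set x : F | exists l, x = `|v - S l| ^+ 2].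
have [||d [d0 dD dinf]] := @scalar_inf R k D.
- by exists (`|v - S [::]| ^+ 2), [::].
- by move=> _ [l ->]; rewrite exprn_ge0.
have {}dD l : d <= `|v - S l| ^+ 2 by apply: dD; exists l.
(* Near-minimisers of the distance to v; the parallelogram law at a midpoint
   makes them close to one another. *)
pose P c u := exists2 l, u = S l & `|v - S l| ^+ 2 <= d + (c / 2) ^+ 2.
have P_ex c : 0 < c -> exists u, P c u.
  move=> c0; have c2 : 0 < (c / 2) ^+ 2 by rewrite exprn_gt0// divr_gt0.
  by have [_ [l ->] /ltW vl] := dinf _ c2; exists (S l), l.
have [//|c c' _ _ c0 c'0 [l -> vl] [l' -> vl']|p Pp] := @hilbert_has_limits E P.
  have [m mE] : exists m, S m = 2^-1 *: (S l + S l').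
    by exists [seq sc 2^-1 z | z <- l ++ l']; rewrite -sum_familyZ big_cat.
  have par : `|S l - S l'| ^+ 2 =
      2 * `|v - S l| ^+ 2 + 2 * `|v - S l'| ^+ 2 - 4 * `|v - S m| ^+ 2.
    have sumE : (v - S l') + (v - S l) = 2 *: (v - S m).
      rewrite mE scalerBr scalerA divff ?pnatr_eq0// scale1r scaler_nat mulr2n.
      by rewrite opprD addrACA [- S l + _]addrC.
    have -> : S l - S l' = (v - S l') - (v - S l).
      by rewrite opprB [RHS]addrC addrA subrK.
    rewrite parallelogram sumE normrZ exprMn normr_nat -natrX [2 * _ + _]addrC.
    by [].
  apply: ler_sqr_scalar => //; first by rewrite addr_ge0// ltW.
  rewrite par.
  have := lerD (ler_wpM2l (ler0n F 2) vl) (ler_wpM2l (ler0n F 2) vl').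
  have := dD m; rewrite -(ler_pM2l (ltr0n F 4)) => dm le2.
  apply: le_trans (lerB le2 dm) _; rewrite -subr_ge0.
  rewrite (_ : _ - _ = 2^-1 * (c ^+ 2 + c' ^+ 2) + 2 * (c * c')); last by field.
  by rewrite addr_ge0// !mulr_ge0 ?addr_ge0 ?exprn_ge0 ?mulr_ge0 ?invr_ge0// ltW.
suff pv : v - p = 0.
  move=> c c0; have [u [l ul vl]] := P_ex c c0; exists l.
  have := Pp c u c0 (ex_intro2 _ _ l ul vl); rewrite ul.
  by rewrite distrC; move/eqP: pv; rewrite subr_eq0 => /eqP <-.
apply: e_orth => z; apply: (@le_eps_eq0 _ _ _ (`|e z| + `|e z|)).
  by rewrite addr_ge0.
move=> c c0 _; have [u [l ul vl]] := P_ex c c0.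
have up := Pp c u c0 (ex_intro2 _ _ l ul vl).
have -> : v - p = (v - u) + (u - p) by rewrite addrA subrK.
rewrite linearDl (le_trans (ler_normD _ _))// mulrDl lerD//; last first.
  by rewrite (le_trans (dotp_CauchySchwarz _ _))// mulrC ler_wpM2l.
have [ez0|ez0] := eqVneq (e z) 0.
  by rewrite ez0 linear0r !normr0 mul0r.
have ez1 : 0 < `|e z| ^+ 2 by rewrite exprn_gt0// normr_gt0.
(* Moving u by t e z, with t minimising the distance along e z, gains
   |s|^2 / |e z|^2, which the near-minimality of u bounds by (c / 2)^2. *)
set s := dotp E (v - u) (e z); pose t := s / `|e z| ^+ 2.
have tc : theta t = theta s / `|e z| ^+ 2.
  by rewrite rmorphM fmorphV [theta (_ ^+ 2)]ger0_scalar_conj ?exprn_ge0.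
have := dD (l ++ [:: sc t z]); rewrite big_cat/= big_seq1 e_sc -ul opprD addrA.
have -> : `|v - u - t *: e z| ^+ 2 = `|v - u| ^+ 2 - `|s| ^+ 2 / `|e z| ^+ 2.
  rewrite -dotp_norm hnormB linearZl_LR !linearZr_LR /= -/s !dotp_norm.
  rewrite expr0 mul1r rmorphM scalar_conjK tc -mul_scalar_conj /t.
  rewrite -[_ *: _]/(_ * _) divfK ?gt_eqF//.
  by move: (theta s) (s) (_ ^-1) (`|v - u| ^+ 2) => *; ring.
move=> dle; rewrite -ul in vl.
have {vl}dle := le_trans dle (lerB vl (lexx _)).
rewrite -addrA lerDl subr_ge0 ler_pdivrMr// -exprMn mulrC in dle.
rewrite (le_trans (ler_sqr_scalar _ _ dle))// ?mulr_ge0 ?divr_ge0 ?(ltW c0)//.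
by rewrite ler_wpM2l// ler_pdivrMr// ler_peMr ?(ltW c0)// ler1n.
Qed.

End Families.

Lemma bounded_comp E W W' (S : bounded_op W W') (T : bounded_op E W) :
  exists U : bounded_op E W', forall v, U v = S (T v).
Proof.
have [M M0 SM] := bounded_op_bound S; have [N N0 TN] := bounded_op_bound T.
apply: (@bounded_op_exists _ _ (fun v => S (T v)) (M * N)).
  by move=> c u v; rewrite !linearP.
by move=> v; rewrite (le_trans (SM _))// -mulrA ler_wpM2l.
Qed.

Lemma sqr_norm_sum E (Z : Type) (e : Z -> E) (l : seq Z) :
  `|\sum_(z <- l) e z| ^+ 2 = \sum_(z <- l) \sum_(z' <- l) dotp E (e z) (e z').
Proof.
rewrite -dotp_norm linear_sumlz; apply: eq_bigr => z _.
by rewrite linear_sumr.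
Qed.

(** Equal Gram matrices give equal norms of finite sums, so that each family
    extends to an isometry in either direction; these are inverse to each
    other. *)
Lemma unitary_of_gram E W (Z : Type) (sc : F -> Z -> Z) (e : Z -> E)
    (w : Z -> W) :
  (forall c z, e (sc c z) = c *: e z) -> (forall c z, w (sc c z) = c *: w z) ->
  total_family e -> total_family w ->
  (forall z z', dotp W (w z) (w z') = dotp E (e z) (e z')) ->
  exists2 U : bounded_op E W, unitary U & forall z, U (e z) = w z.
Proof.
move=> e_sc w_sc e_tot w_tot gram.
have norm_eq l : `|\sum_(z <- l) w z| = `|\sum_(z <- l) e z|.
  apply/eqP; rewrite -(eqrXn2 (n := 2))// !sqr_norm_sum.
  by apply/eqP; apply: eq_bigr => z _; apply: eq_bigr => z' _.
have [|U Ue _] := extension e_sc e_tot ler01 w_sc.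
  by move=> l; rewrite mul1r norm_eq.
have [|U' U'w _] := extension w_sc w_tot ler01 e_sc.
  by move=> l; rewrite mul1r norm_eq.
have UU' : is_adjoint U U'.
  by apply: (total_family_adjoint e_tot w_tot) => z z'; rewrite Ue U'w.
have id_op (V : hilbert R k) : exists T : bounded_op V V, forall v, T v = v.
  apply: (@bounded_op_exists V V id 1) => // v; by rewrite mul1r.
exists U => //; split=> [u v|v].
  rewrite UU'; congr (dotp E u _).
  have [C CE] := bounded_comp U' U; have [I IE] := id_op E.
  rewrite -CE -[RHS]IE; move: v; apply: total_family_op_eq e_tot _ => z.
  by rewrite CE IE Ue U'w.
exists (U' v); have [C CE] := bounded_comp U U'; have [I IE] := id_op W.
rewrite -CE -[RHS]IE; move: v; apply: total_family_op_eq w_tot _ => z.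
by rewrite CE IE U'w Ue.
Qed.

End HilbertTheory.

(** * Reproducing kernel Hilbert spaces *)

Section KernelForm.
Variables (R : realType) (k : scalar_kind).
Local Notation F := (Defs.scalar R k).
Local Notation theta := (scalar_conj R k).
Variables (Y : Type) (H : Y -> hilbert R k).

(** A pair of y and h in H y stands for the vector K_y h. *)
Definition point := {y : Y & H y}.

Definition point_scale (c : F) (z : point) : point :=
  existT _ (projT1 z) (c *: projT2 z).

Variables (K : operator_kernel H).

Definition kernel_entry (z z' : point) : F :=
  dotp (H (projT1 z')) (K (projT1 z') (projT1 z) (projT2 z)) (projT2 z').

Definition kernel_form (l l' : seq point) : F :=
  \sum_(z <- l) \sum_(z' <- l') kernel_entry z z'.

Lemma kernel_form0l l : kernel_form [::] l = 0.
Proof. by rewrite /kernel_form big_nil. Qed.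

Lemma kernel_formDl l l' m :
  kernel_form (l ++ l') m = kernel_form l m + kernel_form l' m.
Proof. by rewrite /kernel_form big_cat. Qed.

Lemma kernel_formZl c l m :
  kernel_form [seq point_scale c z | z <- l] m = c * kernel_form l m.
Proof.
rewrite /kernel_form big_map mulr_sumr; apply: eq_bigr => z _.
rewrite mulr_sumr; apply: eq_bigr => z' _.
by rewrite /kernel_entry/= linearZ linearZl_LR.
Qed.

Hypothesis K_psd : positive_semidefinite K.

Lemma kernel_entryC z z' : kernel_entry z z' = theta (kernel_entry z' z).
Proof. by rewrite /kernel_entry K_psd.1 dotpC. Qed.

Lemma kernel_formC l m : kernel_form l m = theta (kernel_form m l).
Proof.
rewrite /kernel_form exchange_big rmorph_sum; apply: eq_bigr => z _.
by rewrite rmorph_sum; apply: eq_bigr => z' _; exact: kernel_entryC.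
Qed.

Lemma kernel_form_ge0 l : 0 <= kernel_form l l.
Proof.
have := K_psd.2 (size l) (fun i => projT1 (tnth (in_tuple l) i))
  (fun i => projT2 (tnth (in_tuple l) i)).
rewrite /kernel_form; congr (0 <= _); rewrite [RHS]big_tnth.
by apply: eq_bigr => i _; rewrite [RHS]big_tnth.
Qed.

Definition kernel_semi_inner : semi_inner R k :=
  SemiInner kernel_form0l kernel_formDl kernel_formZl kernel_formC
    kernel_form_ge0.

(** The space is the completion of the formal sums of points under the form
    of the kernel. *)
Lemma kolmogorov_decomposition : exists (E : hilbert R k) (e : point -> E),
  [/\ forall c z, e (point_scale c z) = c *: e z,
      forall z z', dotp E (e z) (e z') = kernel_entry z z' &
      total_family e].
Proof.
pose E := completion_hilbert kernel_semi_inner.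
pose e (z : point) : E := embed ([:: z] : kernel_semi_inner).
have sum_e l : \sum_(z <- l) e z = embed (l : kernel_semi_inner) :> E.
  elim: l => [|z l IHl]; apply: completionP => w.
    by rewrite big_nil /= kernel_form0l.
  rewrite big_cons IHl completionDE /= -kernel_formDl.
  by [].
have dot_e z z' : dotp E (e z) (e z') = kernel_entry z z'.
  rewrite [LHS]dot_embedr/= /kernel_form !big_seq1.
  by [].
have e_sc c z : e (point_scale c z) = c *: e z.
  by apply: completionP => w; rewrite completionZE /= -kernel_formZl.
have e_tot : total_family e.
  move=> f d d0; have [l fl] := completion_approx f d0; exists l.
  rewrite sum_e; apply: completion_norm_le; first exact: ltW.
  by move=> w; rewrite completionBE; exact: fl.
by exists E, e.
Qed.

(** Evaluation at x is the extension to the whole space of the map that sends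
    K_y h to K x y h.  It is bounded because u = sum K x y_i h_i satisfies
    |u|^2 = <sum K_(y_i) h_i, K_x u> and |K_x u|^2 = <K x x u, u>. *)
Lemma rkhs_exists : inhabited (rkhs K).
Proof.
have [E [e [e_sc dot_e e_tot]]] := kolmogorov_decomposition.
have eval x : exists T : bounded_op E (H x),
    forall z, T (e z) = K x (projT1 z) (projT2 z).
  have [N N0 KN] := bounded_op_bound (K x x).
  have [|c z|l|T TE _] := @extension _ _ E point e point_scale e_sc (H x)
      (fun z => K x (projT1 z) (projT2 z)) (scalar_sqrt N) e_tot.
  - exact: scalar_sqrt_ge0.
  - by rewrite /= linearZ.
  - set u := \sum_(z <- l) K x _ _.
    have uE : `|u| ^+ 2 = dotp E (\sum_(z <- l) e z) (e (existT _ x u)).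
      rewrite -dotp_norm {1}/u !linear_sumlz; apply: eq_bigr => z _.
      exact/esym/dot_e.
    have eu : `|e (existT _ x u)| <= scalar_sqrt N * `|u|.
      apply: ler_sqr_scalar; [exact: normr_ge0| |].
        by apply: mulr_ge0 => //; exact: scalar_sqrt_ge0.
      rewrite exprMn sqr_scalar_sqrt// -dotp_norm dot_e /kernel_entry/=.
      rewrite -[dotp _ _ _]ger0_norm ?(le_trans (dotp_CauchySchwarz _ _))//.
        by rewrite expr2 mulrA ler_wpM2r.
      by have := kernel_form_ge0 [:: existT _ x u]; rewrite /kernel_form !big_seq1.
    have [->|u0] := eqVneq u 0.
      by rewrite normr0 mulr_ge0 ?scalar_sqrt_ge0.
    rewrite -(ler_pM2r (_ : 0 < `|u|)) ?normr_gt0// -expr2 uE.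
    rewrite -[dotp _ _ _]ger0_norm -?uE ?exprn_ge0// uE.
    rewrite (le_trans (dotp_CauchySchwarz _ _))// mulrC mulrAC.
    by rewrite ler_wpM2r.
  by exists T.
pose T x : bounded_op E (H x) := projT1 (cid (eval x)).
have TE x z : T x (e z) = K x (projT1 z) (projT2 z).
  by rewrite /T; case: cid.
have T_rep f x h : dotp (H x) (T x f) h = dotp E f (e (existT _ x h)).
  apply/eqP; rewrite -subr_eq0; apply/eqP; move: f.
  have [M M0 TM] := bounded_op_bound (T x).
  apply: (@total_family_eq0 _ _ _ _ _ _ _ (M * `|h| + `|e (existT _ x h)|) e_tot).
  - by rewrite addr_ge0 ?mulr_ge0.
  - by move=> f g; rewrite [T x _]linearD !linearDl opprD addrACA.
  - move=> f; rewrite (le_trans (ler_normB _ _))// mulrDl lerD//.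
      by rewrite (le_trans (dotp_CauchySchwarz _ _))// mulrAC ler_wpM2r.
    by rewrite (le_trans (dotp_CauchySchwarz _ _))// mulrC.
  - by move=> z; rewrite TE dot_e /kernel_entry subrr.
have T_inj f g : (forall x, T x f = T x g) -> f = g.
  move=> fg; apply/eqP; rewrite -subr_eq0; apply/eqP.
  apply: (total_family_orthogonal e_tot) => -[x h].
  by rewrite -T_rep linearB fg subrr linear0l.
by constructor; exact: (@RKHS _ _ Y H K E (fun x => T x) T_inj
  (fun x h => e (existT _ x h)) (fun x h y => TE y (existT _ x h))
  (fun f x h => T_rep f x h)).
Qed.

Section RKHSTheory.
Variable r : rkhs K.

Definition rk_vector (z : point) : r := rk_section r (projT1 z) (projT2 z).

Lemma rk_vectorZ c z : rk_vector (point_scale c z) = c *: rk_vector z.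
Proof.
by apply: rk_eval_inj => y; rewrite linearZ /= !rk_sectionE linearZ.
Qed.

Lemma rk_sectionD x h h' :
  rk_section r x (h + h') = rk_section r x h + rk_section r x h'.
Proof. by apply: rk_eval_inj => y; rewrite linearD /= !rk_sectionE linearD. Qed.

Lemma dotp_rk_vector z z' :
  dotp r (rk_vector z) (rk_vector z') = kernel_entry z z'.
Proof. by rewrite -rk_reproducing rk_sectionE. Qed.

(** In any space with the reproducing property a vector orthogonal to all the
    K_x h has all its values equal to 0. *)
Lemma rk_vector_total : total_family rk_vector.
Proof.
apply: (total_family_of_orthogonal rk_vectorZ) => v v_orth.
apply: rk_eval_inj => x; rewrite linear0; apply: dotp_inj => h.
by rewrite rk_reproducing; exact: (v_orth (existT _ x h)).
Qed.

Lemma rk_section_bounded x :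
  exists T : bounded_op (H x) r, forall h, T h = rk_section r x h.
Proof.
have [N N0 KN] := bounded_op_bound (K x x).
apply: (@bounded_op_exists _ _ _ _ (rk_section r x) (scalar_sqrt N)).
  move=> c h h'; rewrite rk_sectionD; congr (_ + _).
  exact: (rk_vectorZ c (existT _ x h)).
move=> h; apply: ler_sqr_scalar; [exact: normr_ge0| |].
  by apply: mulr_ge0 => //; exact: scalar_sqrt_ge0.
rewrite exprMn sqr_scalar_sqrt// -dotp_norm -rk_reproducing rk_sectionE.
rewrite -[dotp _ _ _]ger0_norm ?(le_trans (dotp_CauchySchwarz _ _))//.
  by rewrite expr2 mulrA ler_wpM2r.
by rewrite -(rk_sectionE r) rk_reproducing dotp_norm exprn_ge0.
Qed.

Lemma rk_eval_bounded x :
  exists T : bounded_op r (H x), forall f, T f = rk_eval r x f.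
Proof.
have [S SE] := rk_section_bounded x.
have [N N0 SN] := bounded_op_bound S.
apply: (@bounded_op_exists _ _ _ _ (rk_eval r x) N).
  by move=> c f g; rewrite linearP.
move=> f; set u := rk_eval r x f.
have [->|u0] := eqVneq u 0; first by rewrite normr0 mulr_ge0.
rewrite -(ler_pM2r (_ : 0 < `|u|)) ?normr_gt0// -expr2 -dotp_norm.
rewrite -[dotp _ _ _]ger0_norm ?dotp_ge0// {1}/u rk_reproducing.
rewrite (le_trans (dotp_CauchySchwarz _ _))// -SE mulrC mulrAC.
by rewrite ler_wpM2r.
Qed.

End RKHSTheory.
End KernelForm.

(** * Casts between equal Hilbert spaces *)

Section Casts.
Variables (R : realType) (k : scalar_kind).
Implicit Types V W : hilbert R k.

Lemma hcast_irr V W (e e' : V = W) v : hcast e v = hcast e' v.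
Proof. by rewrite (Prop_irrelevance e e'). Qed.

Lemma hcast_id V (e : V = V) v : hcast e v = v.
Proof. by rewrite (hcast_irr e erefl). Qed.

Lemma hcast_comp V W W' (e : V = W) (e' : W = W') v :
  hcast e' (hcast e v) = hcast (etrans e e') v.
Proof. by case: _ / e' ; case: _ / e. Qed.

Lemma hcastZ V W (e : V = W) c v : hcast e (c *: v) = c *: hcast e v.
Proof. by case: _ / e. Qed.

Lemma hcast0 V W (e : V = W) : hcast e 0 = 0.
Proof. by case: _ / e. Qed.

Lemma dotp_hcast V W (e : V = W) u v : dotp W (hcast e u) (hcast e v) = dotp V u v.
Proof. by case: _ / e. Qed.

Lemma dotp_hcastl V W (e : V = W) (e' : W = V) u v :
  dotp W (hcast e u) v = dotp V u (hcast e' v).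
Proof. by rewrite -(dotp_hcast e') hcast_comp hcast_id. Qed.

(** As bounded operators, casts compose with other operators, and density
    arguments apply to the composites. *)
Lemma hcast_op V W (e : V = W) :
  exists T : bounded_op V W, forall v, T v = hcast e v.
Proof.
case: _ / e; apply: (@bounded_op_exists R k V V id 1) => // v.
by rewrite mul1r.
Qed.

End Casts.

(** * Shifts on the fibres of an action *)

Section Shift.
Variables (R : realType) (k : scalar_kind).
Variables (G : inverse_semigroupoid) (X : Type) (A : left_action G X).
Variable (H : invariant_bundle R k A).
Local Notation F := (Defs.scalar R k).

Definition fibre_point (s : symbol G) := point (@fibre_bundle R k G X A H s).

Definition total_point := {x : X & H x}.

(** Forgetting the symbol allows points over symbols that are equal, but not
    convertible, to be compared without casts. *)
Definition forget (s : symbol G) (z : fibre_point s) : total_point :=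
  existT _ (val (projT1 z)) (projT2 z).

Definition cast_point (s t : symbol G) (e : s = t) (z : fibre_point s) :
  fibre_point t := match e in _ = t return fibre_point t with erefl => z end.

Lemma forget_cast s t (e : s = t) z : forget (cast_point e z) = forget z.
Proof. by case: _ / e. Qed.

Lemma anchor_forget s (z : fibre_point s) : s = anchor A (projT1 (forget z)).
Proof. exact: fibreP. Qed.

Lemma forget_inj s : injective (@forget s).
Proof.
pose mk (p : total_point) (e : projT1 p \in fibre A s) : fibre_point s :=
  existT _ (exist _ (projT1 p) e) (projT2 p).
have mk_irr p q e e' : p = q -> mk p e = mk q e'.
  by move=> pq; move: e e'; rewrite pq => e e'; rewrite (Prop_irrelevance e e').
move=> [[x xs] h] [[y ys] h'] /= zz'.
exact: (mk_irr (existT _ x h) (existT _ y h') xs ys zz').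
Qed.

Lemma total_point_eq (x y : X) (h : H x) (h' : H y) (e : x = y) :
  hcast (congr1 H e) h = h' -> existT _ x h = existT _ y h' :> total_point.
Proof. by move=> <-; case: _ / e. Qed.

Definition shift_total (a : G) (p : total_point)
    (e : dom a = anchor A (projT1 p)) : total_point :=
  existT _ (act A a (projT1 p)) (to_act e (projT2 p)).
Arguments shift_total : clear implicits.

Lemma shift_total_eq a b p q e e' : a = b -> p = q ->
  shift_total a p e = shift_total b q e'.
Proof.
move=> ab pq; move: e e'; rewrite ab pq => e e'.
by rewrite (Prop_irrelevance e e').
Qed.

(** The three casts of the bundle that occur here agree because equality proofs
    between Hilbert spaces are unique. *)
Lemma shift_total_mul a b p (e : dom (sg_mul a b) = anchor A (projT1 p))
    (eb : dom b = anchor A (projT1 p))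
    (ea : dom a = anchor A (projT1 (shift_total b p eb))) :
  dom a = cod b ->
  shift_total (sg_mul a b) p e = shift_total a (shift_total b p eb) ea.
Proof.
move=> ab; rewrite /shift_total /=.
apply: (total_point_eq (e := act_mul ab eb)).
by rewrite /to_act !hcast_comp; exact: hcast_irr.
Qed.

(** The map K_x h to K_(a x) h on formal vectors. *)
Definition shift (a : G) (z : fibre_point (dom a)) : fibre_point (cod a) :=
  existT _ (act_fibre (projT1 z)) (to_act (fibreP (projT1 z)) (projT2 z)).

Lemma forget_shift a z e : forget (@shift a z) = shift_total a (forget z) e.
Proof. by rewrite (Prop_irrelevance e (fibreP (projT1 z))). Qed.

(** Taking z, z' and z'' up to forget makes the product law usable whatever
    casts relate the symbols dom (ab), dom b and cod b to each other. *)
Lemma forget_shift_mul a b (ab : dom a = cod b)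
    (z : fibre_point (dom (sg_mul a b))) (z' : fibre_point (dom b))
    (z'' : fibre_point (dom a)) :
  forget z = forget z' -> forget z'' = forget (shift z') ->
  forget (shift z) = forget (shift z'').
Proof.
move=> zz' z''E.
have ez : dom (sg_mul a b) = anchor A (projT1 (forget z')).
  by rewrite -zz'; exact: anchor_forget.
have eb : dom b = anchor A (projT1 (forget z')) by exact: anchor_forget.
have ea : dom a = anchor A (projT1 (shift_total b (forget z') eb)).
  by rewrite ab; exact/esym/anchor_act.
rewrite (forget_shift (anchor_forget z)) (forget_shift (anchor_forget z'')).
rewrite (shift_total_eq _ ez erefl zz') (shift_total_mul ez ea ab).
by apply: shift_total_eq => //; rewrite z''E; apply/esym/forget_shift.
Qed.

Lemma shift_scale a c z : @shift a (point_scale c z) = point_scale c (shift z).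
Proof. by rewrite /shift /point_scale /= /to_act hcastZ. Qed.

(** The shift by the inverse of a, between the fibres over cod a and dom a. *)
Definition shift_inv (a : G) (z : fibre_point (cod a)) : fibre_point (dom a) :=
  cast_point (cod_inv a) (shift (cast_point (esym (dom_inv a)) z)).

(** The law a a' a = a of an inverse semigroupoid. *)
Lemma shift_invK a z : @shift a (shift_inv (shift z)) = shift z.
Proof.
apply: forget_inj; have [ab ba aba _] := sg_invP a.
have e0 : dom (sg_mul a (sg_inv a)) = cod a by rewrite dom_mul// dom_inv.
have e1 : dom (sg_mul (sg_mul a (sg_inv a)) a) = dom a by rewrite aba.
(* The product law applies to y, which is z viewed over dom ((a a') a). *)
pose y := cast_point (esym e1) z.
transitivity (forget (shift y)); last first.
  rewrite (forget_shift (anchor_forget y)).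
  rewrite (forget_shift (anchor_forget z)).
  by apply: shift_total_eq => //; rewrite forget_cast.
symmetry; rewrite (@forget_shift_mul _ _ e0 y z (cast_point (esym e0) (shift z))).
- apply: (@forget_shift_mul _ _ ab _ (cast_point (esym (dom_inv a)) (shift z))).
    by rewrite !forget_cast.
  by rewrite forget_cast.
- by rewrite forget_cast.
- by rewrite forget_cast.
Qed.

Variable K : operator_kernel H.
Hypothesis K_inv : invariant_kernel K.
Hypothesis K_psd : partially_positive_semidefinite K.

Local Notation entry s := (@kernel_entry R k _ _ (fibre_kernel K s)).
Local Notation form s := (@kernel_form R k _ _ (fibre_kernel K s)).

Lemma kernel_adjoint (x y : X) : anchor A x = anchor A y ->
  is_adjoint (K x y) (K y x).
Proof.
move=> xy; have xP : x \in fibre A (anchor A y) by apply/mem_set.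
have yP : y \in fibre A (anchor A y) by apply/mem_set.
exact: ((K_psd (anchor A y)).1 (exist _ x xP) (exist _ y yP)).
Qed.

(** Invariance of the kernel says that the shifts by a and by its inverse are
    adjoint to each other. *)
Lemma entry_shift a z z' :
  entry (cod a) (shift z) z' = entry (dom a) z (shift_inv z').
Proof.
case: z => x h; case: z' => y h'; rewrite /kernel_entry /=.
set q := shift_inv _.
have eq : dom (sg_inv a) = anchor A (val y).
  exact: etrans (dom_inv a) (fibreP y).
have qE : forget q = shift_total (sg_inv a) (existT _ (val y) h') eq.
  rewrite /q /shift_inv forget_cast (forget_shift (anchor_forget _)).
  by apply: shift_total_eq => //; rewrite forget_cast.
pose f (p : total_point) := dotp (H (projT1 p)) (K (projT1 p) (val x) h) (projT2 p).
rewrite -[RHS]/(f (forget q)) qE /f /= /fibre_kernel /=.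
rewrite [LHS]kernel_adjoint; last first.
  by rewrite -(fibreP y); apply/esym/anchor_act; exact: fibreP.
rewrite (dotp_hcastl _ (bundle_act H (fibreP x))).
rewrite -/(of_act _ _) (K_inv (fibreP x) (fibreP y)) [RHS]kernel_adjoint.
  by rewrite /to_act; congr (dotp _ _ (K _ _ _)); exact: hcast_irr.
by rewrite -(fibreP x) -cod_inv anchor_act.
Qed.

(** Write P for the shift by a followed by that by its inverse.  It is
    symmetric and idempotent, so that <v - P v, v - P v> = <v, v> - <P v, v>,
    and <P v, v> is the form at the shifted vector.  Positivity of the
    left-hand side is the claim. *)
Lemma form_shift_le a (l : seq (fibre_point (dom a))) :
  form (cod a) [seq shift z | z <- l] [seq shift z | z <- l] <= form (dom a) l l.
Proof.
(* The list m is P applied to l. *)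
set C := form (cod a) _ _; pose m := [seq shift_inv (shift z) | z <- l].
have lm : form (dom a) l m = C.
  rewrite /C /kernel_form big_map; apply: eq_bigr => z _.
  by rewrite !big_map; apply: eq_bigr => z' _; rewrite entry_shift.
have mm : form (dom a) m m = C.
  rewrite /C /kernel_form !big_map; apply: eq_bigr => z _.
  by rewrite !big_map; apply: eq_bigr => z' _; rewrite -entry_shift shift_invK.
have psd s := K_psd s.
have ml : form (dom a) m l = C.
  rewrite kernel_formC// lm ger0_scalar_conj//; exact: kernel_form_ge0.
have := kernel_form_ge0 (psd (dom a)) (l ++ [seq point_scale (-1) z | z <- m]).
rewrite kernel_formDl kernel_formZl [form _ l (_ ++ _)]kernel_formC//.
rewrite [form _ m (_ ++ _)]kernel_formC// !kernel_formDl !kernel_formZl.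
rewrite !rmorphD !rmorphM rmorphN1 -!kernel_formC// lm ml mm.
by rewrite !mulN1r subrr oppr0 addr0 subr_ge0.
Qed.

End Shift.

(** * Representations and linearisations *)

Section Representations.
Variables (R : realType) (k : scalar_kind).
Variables (G : inverse_semigroupoid) (X : Type) (A : left_action G X).
Variables (H : invariant_bundle R k A) (K : operator_kernel H).
Hypothesis K_inv : invariant_kernel K.
Hypothesis K_psd : partially_positive_semidefinite K.
#[local] Arguments scast {R k G} B {s t} e v.
Local Notation F := (Defs.scalar R k).
Local Notation Z := (fibre_point H).
Local Notation entry s := (@kernel_entry R k _ _ (fibre_kernel K s)).
Local Notation form s := (@kernel_form R k _ _ (fibre_kernel K s)).

(** A section with finite support is a list of points, and shifts contract the
    form, whence the constant 1. *)
Lemma kernel_bounded_shift : bounded_shift_type K.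
Proof.
move=> a; exists 1; split=> // g g_fin; rewrite mul1r.
pose T := {classic fibre A (dom a)}.
have [s s_uniq g0] : exists2 s : seq T, uniq s & forall y, y \notin s -> g y = 0.
  have /finite_seqP[s sE] : finite_set ([set y | g y != 0] : set T) := g_fin.
  exists (undup s) => [|y]; first exact: undup_uniq.
  rewrite mem_undup; apply: contraNeq => gy.
  by have : [set` s] y by rewrite -sE.
have sum_s (f : T -> F) : (forall y, y \notin s -> f y = 0) ->
    \sum_(y \in [set: T]) f y = \sum_(y <- s) f y.
  move=> f0; rewrite (fsbigE s)//; last by move=> y _; exact: f0.
  by apply: eq_bigl => y; exact: mem_set.
pose pt (y : T) : Z (dom a) := existT _ y (g y).
pose l := [seq pt y | y <- s].
have sumE (f : T -> T -> F) : (forall x y, g x = 0 -> f x y = 0) ->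
    (forall x y, g y = 0 -> f x y = 0) ->
    \sum_(x \in [set: T]) \sum_(y \in [set: T]) f x y =
    \sum_(y <- s) \sum_(x <- s) f x y.
  move=> fx fy; rewrite exchange_big/= sum_s.
    apply: eq_bigr => x _; rewrite sum_s// => y ys.
    by apply: fy; exact: g0.
  by move=> x xs; apply: fsbig1 => y _; apply: fx; exact: g0.
have := form_shift_le K_inv K_psd l; rewrite !sumE.
- rewrite /kernel_form !big_map; congr (_ <= _); apply: eq_bigr => y _;
    rewrite !big_map; apply: eq_bigr => x _ //.
  rewrite /kernel_entry /= /fibre_kernel /=.
  by rewrite [RHS](dotp_hcastl _ (esym (bundle_act H (fibreP x)))).
- by move=> x y ->; rewrite linear0r.
- by move=> x y ->; rewrite linear0 linear0l.
- by move=> x y ->; rewrite linear0r.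
- by move=> x y ->; rewrite /to_act hcast0 linear0 /of_act hcast0 linear0l.
Qed.

(** A total family of vectors with the kernel as Gram matrix is all that the
    construction of the representation needs; sections K_x h in reproducing
    kernel spaces and vectors V_x h in minimal linearisations are both of this
    kind. *)
Section Vectors.
Variables (B : symbol G -> hilbert R k) (vec : forall s, Z s -> B s).
Hypothesis vecZ : forall s c (z : Z s), vec (point_scale c z) = c *: vec z.
Hypothesis vec_gram : forall s (z z' : Z s),
  dotp (B s) (vec z) (vec z') = entry s z z'.
Hypothesis vec_total : forall s, total_family (@vec s).

Lemma scast_vec s t (e : s = t) z :
  scast B e (vec z) = vec (cast_point e z).
Proof. by case: _ / e. Qed.

(** Shifts contract the form, hence extend from the total family. *)
Lemma shift_operator (a : G) : exists T : bounded_op (B (dom a)) (B (cod a)),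
  forall z, T (vec z) = vec (shift z).
Proof.
have [c z|l|T TE _] := @extension _ _ (B (dom a)) _ _ _ (@vecZ _) (B (cod a))
    (fun z => vec (shift z)) 1 (@vec_total _) ler01.
- by rewrite shift_scale vecZ.
- rewrite mul1r; apply: ler_sqr_scalar => //; rewrite !sqr_norm_sum.
  have := form_shift_le K_inv K_psd l; rewrite /kernel_form big_map.
  congr (_ <= _); apply: eq_bigr => z _; rewrite ?big_map; apply: eq_bigr => z' _;
  by rewrite vec_gram.
by exists T.
Qed.

Definition intertwines (Phi : forall a : G, bounded_op (B (dom a)) (B (cod a))) :=
  forall (a : G) (z : Z (dom a)), Phi a (vec z) = vec (shift z).

Lemma intertwines_exists : exists Phi, intertwines Phi.
Proof.
exists (fun a => projT1 (cid (shift_operator a))) => a z.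
by case: cid => T /= ->.
Qed.

Lemma intertwines_unique Phi Psi : intertwines Phi -> intertwines Psi -> Phi = Psi.
Proof.
move=> PhiV PsiV; apply: functional_extensionality_dep => a.
apply: bounded_op_ext; apply: total_family_op_eq (@vec_total _) _ => z.
by rewrite PhiV PsiV.
Qed.

(** Multiplicativity and the adjoint relation hold on the total family, by the
    product law of shifts and by invariance of the kernel. *)
Lemma intertwines_star Phi : intertwines Phi -> star_representation Phi.
Proof.
move=> PhiV; split=> [a b e|a].
  have [C1 C1E] := hcast_op (congr1 B (cod_mul e)).
  have [C2 C2E] := hcast_op (congr1 B (esym (dom_mul e))).
  have [C3 C3E] := hcast_op (congr1 B (esym e)).
  have [U UE] := bounded_comp (Phi (sg_mul a b)) C2.
  have [V VE] := bounded_comp C1 U.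
  have [U' U'E] := bounded_comp C3 (Phi b).
  have [V' V'E] := bounded_comp (Phi a) U'.
  suff VV' v : V v = V' v.
    by move=> v; move: (VV' v); rewrite VE UE C1E C2E V'E U'E C3E.
  move: v; apply: total_family_op_eq (@vec_total _) _ => z.
  rewrite VE UE C1E C2E V'E U'E C3E -!/(scast B _ _).
  rewrite scast_vec !PhiV !scast_vec PhiV.
  congr vec; apply: forget_inj; rewrite forget_cast.
  by apply: (forget_shift_mul e); rewrite forget_cast.
have [C1 C1E] := hcast_op (congr1 B (cod_inv a)).
have [C2 C2E] := hcast_op (congr1 B (esym (dom_inv a))).
have [U UE] := bounded_comp (Phi (sg_inv a)) C2.
have [V VE] := bounded_comp C1 U.
suff adj : is_adjoint (Phi a) V.
  by move=> u v; rewrite adj VE UE C1E C2E.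
apply: (total_family_adjoint (@vec_total _) (@vec_total _)) => z z'.
rewrite VE UE C1E C2E -!/(scast B _ _) scast_vec !PhiV scast_vec !vec_gram.
exact: entry_shift.
Qed.

End Vectors.

Section RKHSBundle.
Variable RK : forall s : symbol G, rkhs (fibre_kernel K s).

Definition rk_family s : Z s -> RK s := @rk_vector R k _ _ _ (RK s).

Lemma rk_familyZ s c (z : Z s) : rk_family (point_scale c z) = c *: rk_family z.
Proof. exact: rk_vectorZ. Qed.

Lemma rk_family_gram s (z z' : Z s) :
  dotp (RK s) (rk_family z) (rk_family z') = entry s z z'.
Proof. exact: dotp_rk_vector. Qed.

Lemma rk_family_total s : total_family (@rk_family s).
Proof. exact: rk_vector_total. Qed.

Lemma rkhs_representation :
  exists! Phi : forall a : G, bounded_op (RK (dom a)) (RK (cod a)),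
     star_representation (B := fun s => RK s) Phi /\
     forall (a : G) (x : fibre A (dom a)) (h : fibre_bundle H x),
       rk_section (RK (cod a)) (act_fibre x) (to_act (fibreP x) h) =
       Phi a (rk_section (RK (dom a)) x h).
Proof.
have [Phi PhiV] := intertwines_exists rk_familyZ rk_family_gram rk_family_total.
exists Phi; split.
  split; first exact: (intertwines_star rk_family_gram rk_family_total PhiV).
  by move=> a x h; rewrite -[RHS]/(Phi a (rk_family (existT _ x h))) PhiV.
move=> Psi [_ PsiV]; apply: (intertwines_unique rk_family_total PhiV).
by move=> a [x h]; rewrite -PsiV.
Qed.

End RKHSBundle.

Definition base_point (x : X) : fibre A (anchor A x) :=
  exist _ x (mem_set (erefl : fibre A (anchor A x) x)).

Section Linearisation.
Variable L : invariant_linearisation K.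

(** V_x h, transported to the space of the symbol s = a(x). *)
Definition il_family s (z : Z s) : il_space L s :=
  scast (il_space L) (esym (fibreP (projT1 z)))
    (il_op L (val (projT1 z)) (projT2 z)).

Lemma il_familyZ s c (z : Z s) : il_family (point_scale c z) = c *: il_family z.
Proof. by rewrite /il_family /= linearZ /scast hcastZ. Qed.

Lemma il_family_base x h : il_family (existT _ (base_point x) h) = il_op L x h.
Proof. by rewrite /il_family /= /scast hcast_id. Qed.

Lemma scast_irr (B : symbol G -> hilbert R k) s t (e e' : s = t) v :
  scast B e v = scast B e' v.
Proof. exact: hcast_irr. Qed.

(** The factorisation K(x, y) = V_x^* V_y says that the Gram matrix of the
    V_x h is the kernel. *)
Lemma il_family_gram s (z z' : Z s) :
  dotp (il_space L s) (il_family z) (il_family z') = entry s z z'.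
Proof.
case: z => x h; case: z' => y h'; rewrite /il_family /kernel_entry /= /fibre_kernel.
have [V' V'adj ->] := il_factor L (etrans (esym (fibreP y)) (fibreP x)).
rewrite [RHS]dotpC -V'adj -dotpC /scast.
rewrite (dotp_hcastl _ (congr1 _ (fibreP x))) hcast_comp.
rewrite [RHS](dotp_hcastl _
  (congr1 (il_space L) (etrans (esym (fibreP y)) (fibreP x)))).
by congr (dotp _ _ _); exact: hcast_irr.
Qed.

Lemma il_family_total : minimal_linearisation L ->
  forall s, total_family (@il_family s).
Proof.
move=> L_min s v d d0.
have : closure (linear_span [set v : il_space L s |
    exists (x : X) (e : anchor A x = s) (h : H x),
      v = scast (il_space L) e (il_op L x h)]) v by rewrite L_min.
move=> /(_ _ (nbhsx_ballx v d d0))[w [[n [c [u [uA ->]]]]]].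
rewrite -ball_normE /ball_ /= => vw.
have pt i : exists z : Z s, c i *: u i = il_family z.
  have [x [e [h ->]]] := uA i.
  have xs : x \in fibre A s by apply/mem_set.
  exists (point_scale (c i) (existT _ (exist _ x xs) h)).
  by rewrite il_familyZ /il_family /=; congr (_ *: _); exact: scast_irr.
have [z zE] := choice pt.
exists [seq z i | i <- enum 'I_n]; rewrite big_map big_enum /=.
by under eq_bigr do rewrite -zE; exact: ltW.
Qed.

Lemma il_rep_intertwines : intertwines (@il_family) (@il_rep _ _ _ _ _ _ _ L).
Proof.
move=> a [x h]; rewrite /il_family /=.
have := il_intertwine L (fibreP x) h; rewrite (scast_irr _ (esym (fibreP x))) => ->.
exact: scast_irr.
Qed.

End Linearisation.

(** In both linearisations the vectors V_x h are total with Gram matrix K, and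
    the representations act on them by the same shifts. *)
Lemma minimal_linearisation_unique (L L' : invariant_linearisation K) :
  minimal_linearisation L -> minimal_linearisation L' ->
  exists U : forall s : symbol G, bounded_op (il_space L s) (il_space L' s),
     [/\ forall s, unitary (U s),
         forall (a : G) (v : il_space L (dom a)),
           U (cod a) (il_rep L a v) = il_rep L' a (U (dom a) v) &
         forall (x : X) (h : H x),
           U (anchor A x) (il_op L x h) = il_op L' x h].
Proof.
move=> /il_family_total L_tot /il_family_total L'_tot.
have Uex s : exists U : bounded_op (il_space L s) (il_space L' s),
    unitary U /\ forall z, U (il_family L z) = il_family L' z.
  have [|U U_unitary UE] := unitary_of_gram (@il_familyZ L s) (@il_familyZ L' s)
    (L_tot s) (L'_tot s).
    by move=> z z'; rewrite !il_family_gram.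
  by exists U.
pose U s := projT1 (cid (Uex s)).
have UU s : unitary (U s) by rewrite /U; case: cid => /= ? [].
have UE s z : U s (il_family L z) = il_family L' z.
  by rewrite /U; case: cid => /= ? [].
exists U; split=> // [a v|x h].
  have [S SE] := bounded_comp (U (cod a)) (il_rep L a).
  have [T TE] := bounded_comp (il_rep L' a) (U (dom a)).
  rewrite -SE -TE; move: v; apply: total_family_op_eq (L_tot _) _ => z.
  by rewrite SE TE UE !il_rep_intertwines UE.
by rewrite -!il_family_base UE.
Qed.

(** The reproducing kernel spaces with V_x h = K_x h and with the
    representation by shifts; the adjoint of V_x is evaluation at x. *)
Lemma minimal_linearisation_exists :
  exists L : invariant_linearisation K, minimal_linearisation L.
Proof.
pose RK s : rkhs (fibre_kernel K s) :=
  projT1 (cid (let: inhabits r := rkhs_exists (K_psd s) in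
    ex_intro (fun=> True) r I)).
have [Phi PhiV] :=
  intertwines_exists (@rk_familyZ RK) (@rk_family_gram RK) (@rk_family_total RK).
have Phi_star := intertwines_star (@rk_family_gram RK) (@rk_family_total RK) PhiV.
pose V x : bounded_op (H x) (RK (anchor A x)) :=
  projT1 (cid (rk_section_bounded (RK (anchor A x)) (base_point x))).
have VE x h : V x h = rk_family RK (existT _ (base_point x) h).
  by rewrite /V; case: cid => /= T ->.
have V_factor x y (e : anchor A x = anchor A y) :
    exists2 Vx' : bounded_op (RK (anchor A x)) (H x), is_adjoint (V x) Vx' &
    forall h : H y, K x y h = Vx' (scast (fun s => RK s) (esym e) (V y h)).
  have [T TE] := rk_eval_bounded (RK (anchor A x)) (base_point x).
  exists T => [h f|h].
    by rewrite TE VE dotpC [RHS]dotpC -rk_reproducing.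
  rewrite VE (scast_vec (@rk_family RK)) TE.
  pose f (p : total_point H) := K x (projT1 p) (projT2 p).
  rewrite rk_sectionE -[RHS]/(f (forget _)).
  by rewrite forget_cast.
have V_intertwine x a (e : dom a = anchor A x) h :
    Phi a (scast (fun s => RK s) (esym e) (V x h)) =
    scast (fun s => RK s) (anchor_act e) (V (act A a x) (to_act e h)).
  rewrite !VE !(scast_vec (@rk_family RK)) PhiV.
  congr (rk_family RK); apply: forget_inj; rewrite forget_cast.
  set z := cast_point _ _.
  rewrite (forget_shift (anchor_forget z)).
  have ez : forget z = existT _ x h by rewrite forget_cast.
  exact: (@shift_total_eq _ _ _ _ _ _ _ _ _ (existT _ x h) _ e erefl ez).
exists (InvariantLinearisation V_factor Phi_star V_intertwine) => s /=.
apply/seteqP; split=> // v _ D /nbhs_ballP[d d0 dD].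
have d2 : 0 < d / 2 by rewrite divr_gt0.
have [l vl] := @rk_family_total RK s v _ d2.
exists (\sum_(z <- l) rk_family RK z); split; last first.
  apply: dD; rewrite -ball_normE /ball_ /= (le_lt_trans vl)//.
  by rewrite ltr_pdivrMr// ltr_pMr// ltr1n.
exists (size l), (fun=> 1), (fun i => rk_family RK (tnth (in_tuple l) i)); split.
  move=> i; set z := tnth _ i.
  exists (val (projT1 z)), (esym (fibreP (projT1 z))), (projT2 z).
  rewrite VE (scast_vec (@rk_family RK)).
  by congr (rk_family RK); apply: forget_inj; rewrite forget_cast.
by rewrite big_tnth; apply: eq_bigr => i _; rewrite scale1r.
Qed.

End Representations.

Theorem corollary3p15 (R : realType) (k : scalar_kind)
  (G : inverse_semigroupoid) (X : Type) (A : left_action G X)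
  (H : invariant_bundle R k A) (K : operator_kernel H)
  (K_invariant : invariant_kernel K)
  (K_psd : partially_positive_semidefinite K) :
  bounded_shift_type K /\
  ((forall s : symbol G, inhabited (rkhs (fibre_kernel K s))) /\
   forall RK : forall s : symbol G, rkhs (fibre_kernel K s),
   exists! Phi : forall a : G, bounded_op (RK (dom a)) (RK (cod a)),
     star_representation (B := fun s => RK s) Phi /\
     forall (a : G) (x : fibre A (dom a)) (h : fibre_bundle H x),
       rk_section (RK (cod a)) (act_fibre x) (to_act (fibreP x) h) =
       Phi a (rk_section (RK (dom a)) x h)) /\
  (exists L : invariant_linearisation K,
   minimal_linearisation L /\
   forall L' : invariant_linearisation K, minimal_linearisation L' ->
   exists U : forall s : symbol G, bounded_op (il_space L s) (il_space L' s),
     [/\ forall s, unitary (U s),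
         forall (a : G) (v : il_space L (dom a)),
           U (cod a) (il_rep L a v) = il_rep L' a (U (dom a) v) &
         forall (x : X) (h : H x),
           U (anchor A x) (il_op L x h) = il_op L' x h]).
Proof.
split; first exact: kernel_bounded_shift.
split.
  split=> [s|RK]; first exact: rkhs_exists.
  exact: rkhs_representation.
have [L L_min] := minimal_linearisation_exists K_invariant K_psd.
exists L; split=> // L'; exact: minimal_linearisation_unique.
Qed.
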